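(* Consider the saddle point problem $\min_x\max_y\,p(x)+x^TBy-y^Tc$, where $p$ is $L_p$-smooth and $\mu_p$-strongly convex ($\mu_p>0$), $B$ is a positive definite matrix (so that $\lambda_{\min}(BB^T)>0$) and $c\in\operatorname{range}B$. Let $(x^*,y^* )$ be its solution, with $\|y^*\|\le\mathcal{D}_y$. Then Algorithm 1 (described in the context, applied to the regularized problem with objective $p(x)+x^TBy-y^Tc-\frac{\varepsilon}{16\mathcal{D}_y^2}\|y\|^2$, and with its auxiliary subproblems solved by a suitable iterative method using multiplications by $B$ and $B^T$) finds an $\varepsilon$-solution of the original problem using $$\mathcal{O}\left(\max\left\{1,\sqrt{\frac{L_p}{\mu_p}}\right\}\log\frac1\varepsilon\right)\quad\text{calls of }\nabla p(x)$$ and $$\mathcal{O}\left(\sqrt{\frac{L_p\lambda_{\max}(BB^T)}{\mu_p\lambda_{\min}(BB^T)}}\,\log^2\frac1\varepsilon\right)\quad\text{calls of }B\text{ or }B^T.$$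
   Context: $\|\cdot\|$ is the Euclidean norm; $L$-smooth means the gradient is $L$-Lipschitz; $\lambda_{\max},\lambda_{\min}$ are largest and smallest eigenvalues. A call of $B$ or $B^T$ is a multiplication of a vector by that matrix. A pair $(\hat x,\hat y)$ is an $\varepsilon$-solution if $\|\hat x-x^*\|^2+\|\hat y-y^*\|^2\le\varepsilon$. In $\mathcal{O}(\cdot)$, $\log\frac1\varepsilon$ suppresses constants inside the logarithm depending on the starting point, $\mathcal{D}_y$ and the problem parameters but not on $\varepsilon$. For a bilinear problem $\min_x\max_yp(x)+x^TBy-q(y)$ with $p$ $L_p$-smooth, $\mu_p$-strongly convex and $q$ $L_q$-smooth, $\mu_q$-strongly convex (here $q(y)=y^Tc+\frac{\varepsilon}{16\mathcal{D}_y^2}\|y\|^2$, $L_q=\mu_q=\frac{\varepsilon}{8\mathcal{D}_y^2}$), put $\tilde p(x)=p(x)-\frac{\mu_p}{2}\|x\|^2$, $\tilde q(y)=q(y)-\frac{\mu_q}{2}\|y\|^2$, $R(x,y)=\frac{\mu_p}{2}\|x\|^2+x^TBy-\frac{\mu_q}{2}\|y\|^2$. Algorithm 1. Input: $x^0=x_f^0$, $y^0=y_f^0$; parameters $\alpha,\eta_x,\eta_y$. For $k=0,1,\dots,K-1$: (1) $x_g^k=\alpha x^k+(1-\alpha)x_f^k$, $\;y_g^k=\alpha y^k+(1-\alpha)y_f^k$; (2) compute an approximate solution $(\hat x^{k+1},\hat y^{k+1})$ of $\min_x\max_yA_\eta^k(x,y)$, where $A_\eta^k(x,y)=\langle\nabla\tilde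 p(x_g^k),x\rangle+\frac{1}{2\eta_x}\|x-x^k\|^2+R(x,y)-\langle\nabla\tilde q(y_g^k),y\rangle-\frac{1}{2\eta_y}\|y-y^k\|^2$, accurate enough that $\eta_x\|\nabla_x A_\eta^k(\hat x^{k+1},\hat y^{k+1})\|^2+\eta_y\|\nabla_y A_\eta^k(\hat x^{k+1},\hat y^{k+1})\|^2\le \frac{1}{6\eta_x}\|\hat x^{k+1}-x^k\|^2+\frac{1}{6\eta_y}\|\hat y^{k+1}-y^k\|^2$; (3) $x^{k+1}=x^k-\eta_x\left(\nabla\tilde p(x_g^k)+\nabla_xR(\hat x^{k+1},\hat y^{k+1})\right)$, $\;y^{k+1}=y^k-\eta_y\left(\nabla\tilde q(y_g^k)-\nabla_yR(\hat x^{k+1},\hat y^{k+1})\right)$; (4) $x_f^{k+1}=x_g^k+\alpha(\hat x^{k+1}-x^k)$, $\;y_f^{k+1}=y_g^k+\alpha(\hat y^{k+1}-y^k)$. Output: $x^K,y^K$. Parameters: if $\frac{L_p}{\mu_p}\ge\frac{L_q}{\mu_q}$ (always the case here), $\alpha=\min\{1,\sqrt{\mu_p/L_p}\}$, $\eta_x=\min\{\frac{1}{3\mu_p},\frac{1}{3L_p\alpha}\}$, $\eta_y=\frac{\mu_p}{\mu_q}\eta_x$.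
   Formalization: The claim is proved for all ε below a positive threshold depending only on L_p, μ_p, D_y and the extreme eigenvalues of BB^T; for larger ε the regularized solution, to which Algorithm 1 converges, need not be an ε-solution of the original problem. *)

(* Defs.v *)
From HB Require Import structures.
From mathcomp Require Import all_boot all_order all_algebra.
From mathcomp Require Import all_classical all_reals all_analysis.

Set Implicit Arguments.
Unset Strict Implicit.
Unset Printing Implicit Defensive.

Import Order.TTheory GRing.Theory Num.Theory.
Import numFieldNormedType.Exports.
Local Open Scope ring_scope.

Section Euclidean.
Context {R : realType} {n : nat}.
Implicit Types (u v x y : 'cV[R]_n) (f : 'cV[R]_n -> R).

Definition dot u v : R := (u^T *m v) 0 0.

(* The library norm `|v| on matrices is the sup norm; the Euclidean norm has to
   be introduced separately (both give the same topology and differentials). *)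
Definition enorm v : R := Num.sqrt (dot v v).

Definition grad f x : 'cV[R]_n := \col_i 'D_(delta_mx i 0) f x.

Definition smooth (L : R) f : Prop :=
  (forall x, differentiable f x) /\
  (forall x y, enorm (grad f x - grad f y) <= L * enorm (x - y)).

Definition strongly_convex (mu : R) f : Prop :=
  forall x y (t : R), 0 <= t -> t <= 1 ->
    f (t *: x + (1 - t) *: y) <=
      t * f x + (1 - t) * f y - mu / 2 * t * (1 - t) * enorm (x - y) ^+ 2.

(* Symmetry is not required. *)
Definition posdef (B : 'M[R]_n) : Prop :=
  forall v, v != 0 -> 0 < dot v (B *m v).

Definition largest_eigenvalue (A : 'M[R]_n) (l : R) : Prop :=
  eigenvalue A l /\ forall a, eigenvalue A a -> a <= l.

Definition smallest_eigenvalue (A : 'M[R]_n) (l : R) : Prop :=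
  eigenvalue A l /\ forall a, eigenvalue A a -> l <= a.

(* (xs, ys) solves min_x max_y F x y. *)
Definition saddle_point (F : 'cV[R]_n -> 'cV[R]_n -> R) xs ys : Prop :=
  forall x y, F xs y <= F xs ys /\ F xs ys <= F x ys.

Definition eps_solution (eps : R) xs ys x y : Prop :=
  enorm (x - xs) ^+ 2 + enorm (y - ys) ^+ 2 <= eps.

End Euclidean.

(* Oracle computations: a tree whose inner nodes query an operation o at a
   vector v and continue with the answer.  The tree itself has no access to the
   operations other than through its queries. *)
Inductive prog (Op V A : Type) : Type :=
| Ret of A
| Call (o : Op) (v : V) (k : V -> prog Op V A).

Arguments Ret {Op V A} _.
Arguments Call {Op V A} _ _ _.

Fixpoint bind {Op V A A' : Type} (m : prog Op V A) (f : A -> prog Op V A') :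
    prog Op V A' :=
  match m with
  | Ret a => f a
  | Call o v k => Call o v (fun w => bind (k w) f)
  end.

Fixpoint lift {Op Op' V A : Type} (h : Op -> Op') (m : prog Op V A) :
    prog Op' V A :=
  match m with
  | Ret a => Ret a
  | Call o v k => Call (h o) v (fun w => lift h (k w))
  end.

Fixpoint run {Op V A : Type} (O : Op -> V -> V) (m : prog Op V A) : A :=
  match m with
  | Ret a => a
  | Call o v k => run O (k (O o v))
  end.

(* Number of queries satisfying sel that are made when m is run with answers O. *)
Fixpoint calls {Op V A : Type} (sel : Op -> bool) (O : Op -> V -> V)
    (m : prog Op V A) : nat :=
  match m with
  | Ret _ => 0%N
  | Call o v k => (sel o + calls sel O (k (O o v)))%N
  end.

Inductive matop := MulB | MulBT.

Inductive op := GradP | Mat of matop.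

Definition is_grad (o : op) : bool := if o is GradP then true else false.
Definition is_mat (o : op) : bool := if o is Mat _ then true else false.

Definition oracle {R : realType} {n : nat} (p : 'cV[R]_n -> R) (B : 'M[R]_n)
    (o : op) (v : 'cV[R]_n) : 'cV[R]_n :=
  match o with
  | GradP => grad p v
  | Mat MulB => B *m v
  | Mat MulBT => B^T *m v
  end.

Record params (R : realType) := Params {
  mu_p : R;
  L_p : R;
  D_y : R;
  lam_max : R;
  lam_min : R
}.

Section StepSizes.
Context {R : realType}.
Variables (P : params R) (eps : R).

Definition mu_q : R := eps / (8 * D_y P ^+ 2).
Definition alpha : R := Num.min 1 (Num.sqrt (mu_p P / L_p P)).
Definition eta_x : R := Num.min (1 / (3 * mu_p P)) (1 / (3 * L_p P * alpha)).
Definition eta_y : R := mu_p P / mu_q * eta_x.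

End StepSizes.

Section Functions.
Context {R : realType} {n : nat}.
Variables (P : params R) (eps : R).
Variables (p : 'cV[R]_n -> R) (B : 'M[R]_n) (c : 'cV[R]_n).
Implicit Types x y xg yg xk yk : 'cV[R]_n.

Definition saddle_obj x y : R := p x + dot x (B *m y) - dot y c.

Definition q_reg y : R := dot y c + eps / (16 * D_y P ^+ 2) * enorm y ^+ 2.

Definition p_tilde x : R := p x - mu_p P / 2 * enorm x ^+ 2.
Definition q_tilde y : R := q_reg y - mu_q P eps / 2 * enorm y ^+ 2.

Definition R_fun x y : R :=
  mu_p P / 2 * enorm x ^+ 2 + dot x (B *m y) - mu_q P eps / 2 * enorm y ^+ 2.

Definition A_eta xg yg xk yk x y : R :=
  dot (grad p_tilde xg) x
  + 1 / (2 * eta_x P) * enorm (x - xk) ^+ 2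
  + R_fun x y
  - dot (grad q_tilde yg) y
  - 1 / (2 * eta_y P eps) * enorm (y - yk) ^+ 2.

Definition accurate xg yg xk yk xh yh : Prop :=
  eta_x P * enorm (grad (fun x => A_eta xg yg xk yk x yh) xh) ^+ 2
  + eta_y P eps * enorm (grad (fun y => A_eta xg yg xk yk xh y) yh) ^+ 2
  <= 1 / (6 * eta_x P) * enorm (xh - xk) ^+ 2
     + 1 / (6 * eta_y P eps) * enorm (yh - yk) ^+ 2.

End Functions.

(* A method for the auxiliary subproblems.  It receives the scalar parameters
   and eps, the vectors grad p_tilde xg, grad q_tilde yg, xk, yk that define
   A_eta, and reaches B only by querying products with B and B^T; it cannot
   query grad p. *)
Definition inner_method (R : realType) : Type :=
  forall n : nat, params R -> R ->
    'cV[R]_n -> 'cV[R]_n -> 'cV[R]_n -> 'cV[R]_n ->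
    prog matop 'cV[R]_n ('cV[R]_n * 'cV[R]_n).

(* cur_xh, cur_yh record the inner solution that produced the iterate. *)
Record state (R : realType) (n : nat) := State {
  cur_x : 'cV[R]_n;
  cur_y : 'cV[R]_n;
  cur_xf : 'cV[R]_n;
  cur_yf : 'cV[R]_n;
  cur_xh : 'cV[R]_n;
  cur_yh : 'cV[R]_n
}.

Section Algorithm.
Context {R : realType} {n : nat}.
Variables (solve : inner_method R) (P : params R) (eps : R) (c : 'cV[R]_n).

Definition x_g (s : state R n) : 'cV[R]_n :=
  alpha P *: cur_x s + (1 - alpha P) *: cur_xf s.
Definition y_g (s : state R n) : 'cV[R]_n :=
  alpha P *: cur_y s + (1 - alpha P) *: cur_yf s.

(* gp is grad p_tilde (x_g s), obtained from one query of grad p; q_tilde is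
   known explicitly and needs no query; the partial gradients of R_fun at the
   inner solution are mu_p xh + B yh and B^T xh - mu_q yh. *)
Definition iteration (s : state R n) : prog op 'cV[R]_n (state R n) :=
  Call GradP (x_g s) (fun g =>
  let gp := g - mu_p P *: x_g s in
  let gq := grad (q_tilde P eps c) (y_g s) in
  bind (lift Mat (solve P eps gp gq (cur_x s) (cur_y s))) (fun xyh =>
  let xh := xyh.1 in
  let yh := xyh.2 in
  Call (Mat MulB) yh (fun Byh =>
  Call (Mat MulBT) xh (fun BTxh =>
  Ret {|
    cur_x := cur_x s - eta_x P *: (gp + (mu_p P *: xh + Byh));
    cur_y := cur_y s - eta_y P eps *: (gq - (BTxh - mu_q P eps *: yh));
    cur_xf := x_g s + alpha P *: (xh - cur_x s);
    cur_yf := y_g s + alpha P *: (yh - cur_y s);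
    cur_xh := xh;
    cur_yh := yh
  |})))).

Fixpoint algorithm (x0 y0 : 'cV[R]_n) (K : nat) :
    prog op 'cV[R]_n (state R n) :=
  match K with
  | 0%N => Ret (State x0 y0 x0 y0 x0 y0)
  | K'.+1 => bind (algorithm x0 y0 K') iteration
  end.

End Algorithm.

(* Main.v *)
(** The regularized problem has a stationary point (xr, yr), which is O(eps)-close
    to the solution because B is invertible. The linear part of q is the whole of
    [q_tilde], so only x needs acceleration: the energy
    |x - xr|^2 + (eta_x / eta_y) |y - yr|^2 + (2 eta_x / alpha) D(xf), D being
    the Bregman divergence of [p_tilde] at xr, shrinks by 1 - alpha / 4 per iteration.
    Eliminating y from a subproblem leaves a linear system whose matrix is
    B B^T plus a multiple of the identity that tends to 0 with eps. The same
    accelerated scheme, without y-part, solves it from x^k: a fixed number of steps,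
    proportional to sqrt (lam_max / lam_min) log (1 / eps), reaches the relative
    accuracy required, and y is recovered so that its residual vanishes. *)

Require Import Defs.
From HB Require Import structures.
From mathcomp Require Import all_boot all_order all_algebra.
From mathcomp Require Import all_classical all_reals all_analysis.
From mathcomp Require Import ring lra.

Set Implicit Arguments.
Unset Strict Implicit.
Unset Printing Implicit Defensive.

Import Order.TTheory GRing.Theory Num.Theory.
Import numFieldNormedType.Exports.
Local Open Scope ring_scope.

(** * Euclidean geometry and gradients *)

(** The obstacle is that y is strongly concave only through the regularization, with modulus of
    order eps. The choice of [eta_y] gives eta_y mu_q = eta_x mu_p, so y contracts at the rate of x
    and only L_p / mu_p governs the outer loop. The price is that the energy weighs the y-error by a
    factor of order eps: squared distance eps requires energy of order eps^2, which merely doubles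
    the logarithm. In a subproblem the accuracy is relative to the step xh - xk, so contracting the
    distance to the exact solution by a prescribed factor suffices. That factor is of order eps^2,
    since the x-residual is the residual of the eliminated system divided by [coef_y], of order eps;
    this is the origin of the second logarithm. The squared bias of the regularization is of order
    eps^2, hence below eps / 4 for small eps. Parameters and starting point enter only inside the
    logarithm and in the threshold for eps, which leaves an absolute constant in front. *)

Section Dot.
Context {R : realType} {n : nat}.
Implicit Types (u v w x y : 'cV[R]_n) (a : R).

Lemma dotE u v : dot u v = \sum_i u i 0 * v i 0.
Proof. by rewrite /dot mxE; apply: eq_bigr => i _; rewrite mxE. Qed.

Lemma dotC u v : dot u v = dot v u.
Proof. by rewrite !dotE; apply: eq_bigr => i _; rewrite mulrC. Qed.

Lemma dotDl u v w : dot (u + v) w = dot u w + dot v w.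
Proof. by rewrite /dot linearD mulmxDl mxE. Qed.

Lemma dotZl a u w : dot (a *: u) w = a * dot u w.
Proof. by rewrite /dot linearZ -scalemxAl mxE. Qed.

Lemma dotNl u w : dot (- u) w = - dot u w.
Proof. by rewrite -scaleN1r dotZl mulN1r. Qed.

Lemma dotDr u v w : dot w (u + v) = dot w u + dot w v.
Proof. by rewrite !(dotC w) dotDl. Qed.

Lemma dotZr a u w : dot w (a *: u) = a * dot w u.
Proof. by rewrite !(dotC w) dotZl. Qed.

Lemma dotNr u w : dot w (- u) = - dot w u.
Proof. by rewrite !(dotC w) dotNl. Qed.

Lemma dot0l w : dot 0 w = 0.
Proof. by rewrite -(scale0r 0) dotZl mul0r. Qed.

Definition dot_linear := (dotDl, dotDr, dotZl, dotZr, dotNl, dotNr).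

Lemma dot_mulmx (B : 'M[R]_n) u v : dot u (B *m v) = dot (B^T *m u) v.
Proof. by rewrite /dot trmx_mul trmxK mulmxA. Qed.

Lemma dot_ge0 u : 0 <= dot u u.
Proof. by rewrite dotE; apply: sumr_ge0 => i _; rewrite -expr2 sqr_ge0. Qed.

Lemma dot_eq0 u : (dot u u == 0) = (u == 0).
Proof.
apply/eqP/eqP => [|->]; last exact: dot0l.
rewrite dotE => /psumr_eq0P u0; apply/colP => i.
rewrite mxE; apply/eqP; rewrite -sqrf_eq0 expr2; apply/eqP/u0 => // j _.
by rewrite -expr2 sqr_ge0.
Qed.

Lemma dot_gt0 u : u != 0 -> 0 < dot u u.
Proof. by rewrite lt_def dot_eq0 dot_ge0 andbT. Qed.

Lemma enorm_sqr u : enorm u ^+ 2 = dot u u.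
Proof. by rewrite sqr_sqrtr ?dot_ge0. Qed.

Lemma enorm_ge0 u : 0 <= enorm u.
Proof. exact: sqrtr_ge0. Qed.

Lemma enorm_le u a : 0 <= a -> (enorm u <= a) = (dot u u <= a ^+ 2).
Proof. by move=> a0; rewrite -enorm_sqr ler_pXn2r ?nnegrE ?enorm_ge0. Qed.

Lemma enormZ a u : enorm (a *: u) = `|a| * enorm u.
Proof. by rewrite /enorm dotZl dotZr mulrA -expr2 sqrtrM ?sqr_ge0 // sqrtr_sqr. Qed.

Lemma enormN u : enorm (- u) = enorm u.
Proof. by rewrite /enorm dotNl dotNr opprK. Qed.

Lemma CauchySchwarz_sqr u v : dot u v ^+ 2 <= dot u u * dot v v.
Proof.
have [->|v0] := eqVneq v 0; first by rewrite dotC !dot0l expr0n mulr0.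
have := dot_ge0 (dot v v *: u - dot u v *: v).
rewrite !dot_linear (dotC v u) => h; have := dot_gt0 v0 => vv.
rewrite -(ler_pM2l vv); lra.
Qed.

Lemma CauchySchwarz u v : dot u v <= enorm u * enorm v.
Proof.
rewrite -(ger0_norm (mulr_ge0 (enorm_ge0 u) (enorm_ge0 v))).
apply: le_trans (ler_norm _) _; rewrite -ler_sqr ?nnegrE //.
by rewrite !real_normK ?num_real // exprMn !enorm_sqr CauchySchwarz_sqr.
Qed.

Lemma dotDD u v : dot (u + v) (u + v) <= 2 * dot u u + 2 * dot v v.
Proof.
have := dot_ge0 (u - v); rewrite !dot_linear (dotC v u) => h; lra.
Qed.

End Dot.

(** The difference quotient equals [a + h * b] exactly. The explicit quadratics below are
    differentiated through such an expansion instead of rules for [dot]. *)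
Lemma derive_quadratic {R : realType} (V : normedModType R) (f : V -> R) (x v : V)
    (a b : R) :
  (forall h, f (h *: v + x) = f x + h * a + h ^+ 2 * b) ->
  is_derive x v f a.
Proof.
move=> E.
have cv : ((fun h : R => h^-1 *: ((f \o shift x) (h *: v) - f x)%R) @ 0^' --> a)%classic.
  have -> : a = a + 0 * b by rewrite mul0r addr0.
  apply: (@cvg_trans _ ((fun h : R => a + h * b) @ 0^')%classic).
    apply: near_eq_cvg; near=> h; have h0 : h != 0 by near: h; exact: nbhs_dnbhs_neq.
    have -> : ((f \o shift x) (h *: v) - f x)%R = h * (a + h * b).
      by rewrite /shift /= E; ring.
    by rewrite [RHS]mulKf.
  apply: cvg_within_filter.
  by apply: cvgD; [exact: cvg_cst|apply: cvgM; [exact: cvg_id|exact: cvg_cst]].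
split; first by apply/cvg_ex; exists a.
exact: cvg_lim.
Unshelve. all: by end_near. Qed.

Section Gradient.
Context {R : realType} {n : nat}.
Implicit Types (u v w x y d : 'cV[R]_n) (f : 'cV[R]_n -> R).

Lemma cV_sum_delta v : v = \sum_i v i 0 *: delta_mx i 0.
Proof. by rewrite [LHS]matrix_sum_delta; apply: eq_bigr => i _; rewrite big_ord1. Qed.

Lemma derive_grad f x v : differentiable f x -> 'D_v f x = dot (grad f x) v.
Proof.
move=> df; rewrite deriveE // [in LHS](cV_sum_delta v) linear_sum dotE.
by apply: eq_bigr => i _; rewrite linearZ /= mxE deriveE // mulrC.
Qed.

Lemma is_derive_line f x d (t : R) : differentiable f (x + t *: d) ->
  is_derive t 1 (fun s : R => f (x + s *: d)) (dot (grad f (x + t *: d)) d).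
Proof.
move=> df.
have E : (fun h : R => h^-1 *: (((fun s : R => f (x + s *: d)) \o shift t) (h *: 1)
             - f (x + t *: d))) =
         (fun h : R => h^-1 *: ((f \o shift (x + t *: d)) (h *: d)
             - f (x + t *: d))).
  apply/funext => h /=; congr (_ *: (f _ - _)).
  by rewrite /shift /= [h *: 1]mulr1 scalerDl addrCA.
split; first by rewrite /derivable E; exact: diff_derivable.
by rewrite -(derive_grad _ df) /derive E.
Qed.

Lemma grad_quadratic f x v (b : 'I_n -> R) :
  (forall i h, f (h *: delta_mx i 0 + x) = f x + h * v i 0 + h ^+ 2 * b i) ->
  grad f x = v.
Proof.
move=> E; apply/colP => i; rewrite mxE.
by have [_ ->] := derive_quadratic (E i).
Qed.

End Gradient.

(** * Smooth and strongly convex functions *)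

Section SmoothConvex.
Context {R : realType} {n : nat}.
Implicit Types (u v w x y d : 'cV[R]_n) (f : 'cV[R]_n -> R).

(** The mean value theorem for [psi], whose derivative is nonpositive on [0, 1] by the Lipschitz
    bound and Cauchy-Schwarz, replaces the usual integral of the gradient. *)
Lemma smooth_descent (L : R) f x y : smooth L f ->
  f y <= f x + dot (grad f x) (y - x) + L / 2 * dot (y - x) (y - x).
Proof.
move=> [df Lf]; set d := y - x; set a := dot (grad f x) d.
pose b := L / 2 * dot d d; pose G t := dot (grad f (x + t *: d)) d.
pose psi t := f (x + t *: d) - (t * a + t ^+ 2 * b).
have dpsi (t : R) : is_derive t 1 psi (G t - (a + 2 * t * b)).
  apply: is_deriveB; first exact: is_derive_line.
  apply: (derive_quadratic (b := b)) => h.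
  by rewrite [h *: 1]mulr1; ring.
have cpsi : {within `[0, 1]%classic, continuous psi}%classic.
  by apply: derivable_within_continuous => t _; case: (dpsi t).
have [t] := @MVT_segment R psi _ 0 1 ler01 (fun t _ => dpsi t) cpsi.
rewrite in_itv /= => /andP[t0 t1].
have : G t - a <= t * L * dot d d.
  rewrite /G /a -dotNl -dotDl; apply: le_trans (CauchySchwarz _ _) _.
  have := Lf (x + t *: d) x.
  rewrite addrAC subrr add0r => h.
  apply: le_trans (ler_wpM2r (enorm_ge0 d) h) _.
  have -> : enorm (t *: d) = t * enorm d.
    by rewrite enormZ ger0_norm.
  by rewrite -enorm_sqr; lra.
rewrite /psi scale1r scale0r addr0 [x + d]addrC subrK /b => h1 h2.
nra.
Qed.

(** Divide by [t] and let [t] tend to 0; the [t] chosen makes [t * K] at most [e]. *)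
Lemma le0_of_quadratic (X K : R) :
  (forall t, 0 < t -> t <= 1 -> t * X <= t ^+ 2 * K) -> X <= 0.
Proof.
move=> h; apply/ler_addgt0Pr => e e0; rewrite add0r.
have K1 : 0 < 1 + `|K| by rewrite ltr_pwDl.
pose t := Num.min 1 (e / (1 + `|K|)).
have t0 : 0 < t by rewrite lt_min ltr01 divr_gt0.
have := h t t0; rewrite ge_min lexx => /(_ isT).
rewrite expr2 -mulrA ler_pM2l // => /le_trans; apply.
have te : t * (1 + `|K|) <= e by rewrite -ler_pdivlMr // ge_min lexx orbT.
have := ler_norm K => Kn; nra.
Qed.

Lemma strongly_convex_grad (mu L : R) f x y : smooth L f -> strongly_convex mu f ->
  f x + dot (grad f x) (y - x) + mu / 2 * dot (y - x) (y - x) <= f y.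
Proof.
move=> sf cf; move Ed: (y - x) => d; rewrite -subr_le0.
(* Strong convexity bounds [f z] from above and descent from [z] to [x] bounds it from below. The
   second-order errors are [L / 2] from descent, [L] from replacing the gradient at [z] by the one
   at [x], and [mu / 2] from the factor [t * (1 - t)]. *)
apply: (@le0_of_quadratic _ ((3 * L / 2 + mu / 2) * dot d d)) => t t0 t1.
have := cf y x t (ltW t0) t1; rewrite enorm_sqr Ed.
have -> : t *: y + (1 - t) *: x = x + t *: d.
  by rewrite -Ed scalerBr scalerBl scale1r [RHS]addrCA.
set z := x + t *: d => h1.
have := smooth_descent z x sf.
have -> : x - z = - t *: d by rewrite /z opprD addrA subrr add0r scaleNr.
rewrite !dot_linear => h2.
have : dot (grad f x - grad f z) d <= t * L * dot d d.
  apply: le_trans (CauchySchwarz _ _) _.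
  have := sf.2 x z.
  have -> : x - z = - t *: d by rewrite /z opprD addrA subrr add0r scaleNr.
  move=> h; apply: le_trans (ler_wpM2r (enorm_ge0 d) h) _.
  have -> : enorm (- t *: d) = t * enorm d.
    by rewrite enormZ normrN gtr0_norm.
  by rewrite -enorm_sqr; lra.
rewrite !dot_linear => /(ler_wpM2l (ltW t0)) h3; lra.
Qed.

(** The step [- L^-1 *: g] would lower the upper bound by [dot g g / (2 * L)]. *)
Lemma stationary_of_min (L : R) f g x : 0 < L ->
  (forall y, f y <= f x + dot g (y - x) + L / 2 * dot (y - x) (y - x)) ->
  (forall y, f x <= f y) -> g = 0.
Proof.
move=> L0 D m; apply/eqP; rewrite -dot_eq0 eq_le dot_ge0 andbT.
have := le_trans (m _) (D (x - L^-1 *: g)).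
rewrite [x - _]addrC addrK !dot_linear.
set a := dot g g => h; rewrite -(pmulr_rle0 _ (_ : 0 < L^-1)) ?invr_gt0 //.
have E : L / 2 * - (L^-1 * - (L^-1 * a)) = L^-1 * a / 2 by field; rewrite gt_eqF.
move: h; rewrite ?E; lra.
Qed.

Lemma dot_delta u i : dot u (delta_mx i 0) = u i 0.
Proof.
rewrite dotE (bigD1 i) //= big1 ?addr0 ?mxE ?eqxx ?mulr1 // => j ji.
by rewrite mxE (negbTE ji) mulr0.
Qed.

Lemma coord_le_dot u i : u i 0 ^+ 2 <= dot u u.
Proof.
rewrite dotE (bigD1 i) //= -expr2 lerDl; apply: sumr_ge0 => j _.
by rewrite -expr2 sqr_ge0.
Qed.

Lemma dot_le_supnorm (u : 'rV[R]_n) : dot u^T u^T <= n%:R * `|u| ^+ 2.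
Proof.
rewrite dotE.
have -> : n%:R * `|u| ^+ 2 = \sum_(i < n) `|u| ^+ 2.
  by rewrite sumr_const card_ord mulr_natl.
apply: ler_sum => i _; rewrite mxE -expr2 -real_normK ?num_real //.
rewrite ler_pXn2r ?nnegrE // [leRHS]mx_normrE.
exact: (@le_bigmax _ _ _ _ (fun ij => `|u ij.1 ij.2|) (0, i)).
Qed.

(** The two quadratic bounds give continuity of [f], hence a minimum on a compact box, and growth
    outside the box, so this minimum is global. Stated for abstract [f] and [g] in order to serve
    both the regularized problem and the linear system of a subproblem. *)
Lemma exists_stationary (mu L : R) f (g : 'cV[R]_n -> 'cV[R]_n) :
  0 < mu -> 0 < L ->
  (forall x y, f x + dot (g x) (y - x) + mu / 2 * dot (y - x) (y - x) <= f y) ->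
  (forall x y, f y <= f x + dot (g x) (y - x) + L / 2 * dot (y - x) (y - x)) ->
  exists x, g x = 0.
Proof.
move=> mu0 L0 lo up.
(* Beyond this radius the quadratic term of the lower bound at 0 dominates the linear one, so [f] is
   at least [f 0] there. *)
pose r := 2 * enorm (g 0) / mu.
have r0 : 0 <= r by rewrite divr_ge0 ?mulr_ge0 ?enorm_ge0 ?ltW.
pose A := [set u : 'rV[R]_n | forall i, `[- r, r]%classic (u ord0 i)]%classic.
have cA : compact A.
  exact: (@rV_compact R n (fun=> `[- r, r]%classic) (fun=> @segment_compact _ _ _)).
have A0 : A 0 by move=> i; rewrite /= in_itv /= mxE oppr_cp0 r0.
have cf : continuous (fun u : 'rV[R]_n => f u^T).
  move=> u; apply/(@cvgrPdist_le _ _ _ (nbhs u)) => e e0.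
  pose N : R := n%:R + 1.
  pose K := enorm (g u^T) * N + L / 2 * N.
  have N0 : 0 <= n%:R :> R by [].
  have K0 : 0 <= K by rewrite addr_ge0 ?mulr_ge0 ?enorm_ge0 ?addr_ge0 // ltW.
  have K1 : 0 < K + 1 by lra.
  have Kball (q : R) : 0 < q -> \forall v \near u, `|v - u| <= q.
    move=> q0; apply: filterS (nbhsx_ballx u q q0) => v.
    by rewrite mx_norm_ball /ball_ /= distrC; exact: ltW.
  near=> v.
  have d1 : `|v - u| <= 1 by near: v; exact: Kball.
  have d2 : `|v - u| <= e / (K + 1) by near: v; apply: Kball; exact: divr_gt0.
  move: d1 d2; set d := v - u => d1 d2.
  have := normr_ge0 d; move: d2; rewrite ler_pdivlMr // => d2 d0.
  have dd := dot_le_supnorm d.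
  have ed : enorm d^T <= N * `|d|.
    rewrite enorm_le ?mulr_ge0 ?addr_ge0 //; apply: le_trans dd _.
    by rewrite exprMn ler_wpM2r ?sqr_ge0 // /N; nra.
  have dd' : dot d^T d^T <= N * `|d|.
    apply: le_trans dd _; apply: ler_pM; rewrite ?sqr_ge0 //; first by rewrite lerDl.
    by rewrite expr2 -[leRHS]mulr1 ler_wpM2l.
  have c1 := CauchySchwarz (g u^T) d^T.
  have c2 := CauchySchwarz (- g u^T) d^T.
  rewrite dotNl enormN in c2.
  have c3 : enorm (g u^T) * enorm d^T <= enorm (g u^T) * N * `|d|.
    by rewrite -mulrA ler_wpM2l ?enorm_ge0.
  have := lo u^T v^T; have := up u^T v^T; rewrite -linearB /= -/d => l1 l2.
  have := dot_ge0 d^T => l3.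
  have c4 : L / 2 * dot d^T d^T <= L / 2 * N * `|d|.
    by rewrite -[leRHS]mulrA ler_wpM2l // ltW // divr_gt0.
  have c5 : 0 <= mu / 2 * dot d^T d^T by rewrite mulr_ge0 // ltW // divr_gt0.
  have c6 : 0 <= L / 2 * N * `|d| by rewrite !mulr_ge0 ?addr_ge0 // ltW.
  by rewrite distrC ler_norml; move: d2; rewrite /K => d2; apply/andP; split; lra.
have [u uA um] := @compact_EVT_min _ _ (fun u : 'rV[R]_n => f u^T) A (ex_intro _ 0 A0) cA
  (continuous_subspaceT cf).
exists u^T.
apply: (@stationary_of_min L f _ _ L0 (up _)) => y.
have [yA|yA] := pselect (A y^T); first by have := um y^T; rewrite inE trmxK; apply.
have := um 0; rewrite inE trmx0 => /(_ A0) /le_trans; apply.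
apply: le_trans (lo 0 y); rewrite subr0.
have := CauchySchwarz (- g 0) y; rewrite dotNl enormN => h.
have [i yi] : exists i, r < `|y i 0|.
  have /existsNP[i yi] : ~ forall i, `[- r, r]%classic (y^T ord0 i) by [].
  exists i; rewrite ltNge; apply/negP => yi2; apply: yi.
  by rewrite /= in_itv /= mxE -ler_norml.
have : r <= enorm y.
  apply: le_trans (ltW yi) _; rewrite -ler_sqr ?nnegrE ?enorm_ge0 //.
  by rewrite enorm_sqr real_normK ?num_real // coord_le_dot.
rewrite /r ler_pdivrMr // -enorm_sqr => h2.
have := enorm_ge0 y; nra.
Unshelve. all: by end_near. Qed.

End SmoothConvex.

(** * Rayleigh quotients *)

Section Rayleigh.
Context {R : realType} {n : nat}.
Implicit Types (u v w : 'cV[R]_n) (A : 'M[R]_n).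

Lemma mulmx_bounded A : exists2 F, 1 <= F & forall v, dot (A *m v) (A *m v) <= F * dot v v.
Proof.
exists (1 + \sum_i dot (row i A)^T (row i A)^T) => [|v].
  by rewrite lerDl sumr_ge0 // => i _; exact: dot_ge0.
apply: (@le_trans _ _ ((\sum_i dot (row i A)^T (row i A)^T) * dot v v)); last first.
  by rewrite ler_wpM2r ?dot_ge0 // lerDr.
rewrite [X in X <= _]dotE mulr_suml; apply: ler_sum => i _; rewrite -expr2.
have -> : (A *m v) i 0 = dot (row i A)^T v; last exact: CauchySchwarz_sqr.
by rewrite /dot trmxK -row_mul [RHS]mxE.
Qed.

(* [0 <= <x, N x>] at [x = v - N v / F]. *)
Lemma psd_sqr_le (N : 'M[R]_n) (F : R) : 0 < F -> N^T = N ->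
  (forall v, 0 <= dot v (N *m v)) -> (forall v, dot v (N *m v) <= F * dot v v) ->
  forall v, dot (N *m v) (N *m v) <= F * dot v (N *m v).
Proof.
move=> F0 symN psd NF v; set w := N *m v.
have := psd (v - F^-1 *: w); rewrite mulmxBr -scalemxAr -/w !dot_linear.
rewrite (dot_mulmx N v w) symN -/w => h; rewrite -ler_pdivrMl //.
have : F^-1 * (F^-1 * dot w (N *m w)) <= F^-1 * dot w w.
  by rewrite ler_pM2l ?invr_gt0 // ler_pdivrMl.
lra.
Qed.

(** Invertibility gives |v|^2 <= G |N v|^2, and [psd_sqr_le] gives |N v|^2 <= F <v, N v>. *)
Lemma psd_coercive (N : 'M[R]_n) : N^T = N -> N \in unitmx ->
  (forall v, 0 <= dot v (N *m v)) ->
  exists2 c, 0 < c & forall v, c * dot v v <= dot v (N *m v).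
Proof.
move=> symN uN psd.
have [F F1 FN] := mulmx_bounded N.
have [G G1 GN] := mulmx_bounded (invmx N).
have F0 : 0 < F by apply: lt_le_trans F1.
have G0 : 0 < G by apply: lt_le_trans G1.
have NF v : dot v (N *m v) <= F * dot v v.
  have := FN v; have := dot_ge0 (v - N *m v).
  rewrite !dot_linear (dotC (N *m v) v) => h1 h2.
  by have := ler_wpM2r (dot_ge0 v) F1; lra.
exists (F^-1 * G^-1) => [|v]; first by rewrite mulr_gt0 ?invr_gt0.
rewrite -mulrA ler_pdivrMl //; apply: le_trans (psd_sqr_le F0 symN psd NF v).
by have := GN (N *m v); rewrite mulKmx // -ler_pdivrMl.
Qed.

(** Let [sup S] be the best constant in the Rayleigh bound. Were [A - (sup S)%:M] invertible,
    [psd_coercive] would improve that constant; so [sup S] is an eigenvalue and is at least [l]. *)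
Lemma rayleigh_min A (l : R) : A^T = A -> (forall a, eigenvalue A a -> l <= a) ->
  forall v, l * dot v v <= dot v (A *m v).
Proof.
move=> symA minl v.
have [->|v0] := eqVneq v 0; first by rewrite dot0l mulr0 dot0l.
pose S := [set m : R | forall u, m * dot u u <= dot u (A *m u)]%classic.
have S_ub w (w0 : w != 0) : ubound S (dot w (A *m w) / dot w w).
  by move=> m Sm; rewrite ler_pdivlMr ?dot_gt0.
have supS : has_sup S.
  split; last by exists (dot v (A *m v) / dot v v); exact: S_ub.
  have [F F0 FA] := mulmx_bounded A.
  (* Lower bound of the Rayleigh quotient obtained from 0 <= |u + A u|^2. *)
  exists (- ((1 + F) / 2)) => u.
  have := FA u; have := dot_ge0 (u + A *m u).
  by rewrite !dot_linear (dotC (A *m u) u); lra.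
have Ssup : S (sup S).
  move=> u; have [->|u0] := eqVneq u 0; first by rewrite dot0l mulr0 dot0l.
  rewrite -ler_pdivlMr ?dot_gt0 //; apply: ge_sup; [exact: supS.1|exact: S_ub].
apply: le_trans (Ssup v); rewrite ler_wpM2r ?dot_ge0 //; apply: minl.
pose N := A - (sup S)%:M.
have NE u : dot u (N *m u) = dot u (A *m u) - sup S * dot u u.
  by rewrite mulmxBl mul_scalar_mx !dot_linear.
apply: contraT; rewrite negbK kermx_eq0 row_free_unit => uN.
have [|u|c c0 cN] := @psd_coercive N _ uN.
- by rewrite linearB /= symA tr_scalar_mx.
- by rewrite NE subr_ge0.
have : S (sup S + c) by move=> u; have := cN u; rewrite NE; lra.
by move=> /(sup_upper_bound supS); rewrite gerDl leNgt c0.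
Qed.

Lemma rayleigh_max A (l : R) : A^T = A -> (forall a, eigenvalue A a -> a <= l) ->
  forall v, dot v (A *m v) <= l * dot v v.
Proof.
move=> symA maxl v.
have symN : (- A)^T = - A by rewrite linearN /= symA.
have minN a : eigenvalue (- A) a -> - l <= a.
  rewrite /eigenvalue /eigenspace => h.
  rewrite lerNl; apply: maxl.
  move: h; rewrite /eigenvalue /eigenspace; apply: contra.
  rewrite !kermx_eq0 !row_free_unit => h.
  have -> : - A - a%:M = - (A - (- a)%:M) by rewrite raddfN /= opprK opprD.
  by rewrite -scaleN1r unitmxZ // unitrN unitr1.
by have := rayleigh_min symN minN v; rewrite mulNmx dotNr; lra.
Qed.

(** The nonzero vector is returned as a witness of positive dimension, which comparing [mu_p] with
    [L_p] requires. *)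
Lemma eigenvalue_gram_gt0 (B : 'M[R]_n) a : posdef B -> eigenvalue (B *m B^T) a ->
  exists2 v : 'cV[R]_n, v != 0 & 0 < a.
Proof.
move=> pB /eigenvalueP [u ua u0].
have v0 : u^T != 0 by rewrite trmx_eq0.
exists u^T => //.
have E : (B *m B^T) *m u^T = a *: u^T.
  by have := congr1 trmx ua; rewrite !trmx_mul trmxK linearZ.
have Bv : B^T *m u^T != 0.
  apply/eqP => Bv; have := pB _ v0.
  by rewrite dot_mulmx Bv dot0l ltxx.
have := dot_gt0 Bv; rewrite -dot_mulmx mulmxA E dotZr.
by rewrite pmulr_lgt0 // dot_gt0.
Qed.
End Rayleigh.

(** * Accelerated steps *)

Section Acceleration.
Context {R : realType} {n : nat}.
Implicit Types (x y z d : 'cV[R]_n) (B : 'M[R]_n).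

(** Smoothness goes from [xg] to the new [xf]; convexity at [xg] is used towards the old [xf] with
    weight [1 - al] and towards [z] with weight [al]. The definition of [xg] makes the three
    directions combine into [al *: (xh - z)]. *)
Lemma coupling_inequality (D : 'cV[R]_n -> R) g (L al : R) x xf xg xh z :
  xg = al *: x + (1 - al) *: xf ->
  0 <= al <= 1 -> D z = 0 ->
  (forall a b, D a + dot (g a) (b - a) <= D b) ->
  (forall a b, D b <= D a + dot (g a) (b - a) + L / 2 * dot (b - a) (b - a)) ->
  D (xg + al *: (xh - x)) - (1 - al) * D xf
    - L / 2 * al ^+ 2 * dot (xh - x) (xh - x) <= al * dot (g xg) (xh - z).
Proof.
move=> Exg /andP[al0 al1] Dz lo up.
have := up xg (xg + al *: (xh - x)).
have -> : xg + al *: (xh - x) - xg = al *: (xh - x) by rewrite addrAC subrr add0r.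
rewrite [X in _ + L / 2 * X]dotZl [dot (xh - x) (al *: _)]dotZr => h1.
have al2 : 0 <= 1 - al by lra.
have := ler_wpM2l al2 (lo xg xf); have := ler_wpM2l al0 (lo xg z); rewrite Dz => h2 h3.
have -> : al * dot (g xg) (xh - z) = dot (g xg) (al *: (xh - x)) -
    (1 - al) * dot (g xg) (xf - xg) - al * dot (g xg) (z - xg).
  rewrite -!dotZr -!dotNr -!dotDr; congr dot; apply/colP => i.
  by rewrite Exg !mxE; ring.
lra.
Qed.

(** Three-point identity behind the extragradient step: the increment [a - b] is tested at the
    intermediate point [h], at the cost of |h - a|^2 and the gain of |h - b|^2. *)
Lemma dot_sub_diff (a b h z : 'cV[R]_n) :
  dot (a - z) (a - z) =
    dot (b - z) (b - z) + 2 * dot (a - b) (h - z)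
    + dot (h - a) (h - a) - dot (h - b) (h - b).
Proof.
rewrite !dot_linear (dotC z a) (dotC z b) (dotC h a) (dotC h b).
by ring.
Qed.

Lemma dot_sub_le (x h z : 'cV[R]_n) :
  dot (x - z) (x - z) <= 2 * dot (h - z) (h - z) + 2 * dot (h - x) (h - x).
Proof.
have := dotDD (h - z) (- (h - x)).
by rewrite dotNl dotNr opprK opprB addrC addrA subrK.
Qed.

(* [w] is the ratio of the step sizes in x and y. The energy is multiplied by
   the step size in x, so that no division by the step sizes occurs. *)
Lemma extragradient_contraction (D : 'cV[R]_n -> R) g B
    (L mu w al eta : R) x xf xh x' y yh y' z zy :
  0 < al <= 1 -> 0 <= w -> 0 <= eta -> 0 <= mu ->
  al <= 3 * mu * eta -> 3 * mu * eta <= 1 -> 3 * L * al * eta <= 1 ->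
  D z = 0 -> (forall a, 0 <= D a) ->
  (forall a b, D a + dot (g a) (b - a) <= D b) ->
  (forall a b, D b <= D a + dot (g a) (b - a) + L / 2 * dot (b - a) (b - a)) ->
  let xg := al *: x + (1 - al) *: xf in
  x' - x = - eta *: (g xg + mu *: (xh - z) + B *m (yh - zy)) ->
  w *: (y' - y) = - eta *: ((w * mu) *: (yh - zy) - B^T *m (xh - z)) ->
  dot (xh - x') (xh - x') + w * dot (yh - y') (yh - y') <=
    (dot (xh - x) (xh - x) + w * dot (yh - y) (yh - y)) / 6 ->
  dot (x' - z) (x' - z) + w * dot (y' - zy) (y' - zy)
    + 2 * eta / al * D (xg + al *: (xh - x)) <=
  (1 - al / 4) * (dot (x - z) (x - z) + w * dot (y - zy) (y - zy)
    + 2 * eta / al * D xf).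
Proof.
move=> /andP[al0 al1] w0 eta0 mu0 almu mueta Leta Dz D0 lo up xg Ex Ey acc.
have al01 : 0 <= al <= 1 by rewrite ltW.
have := coupling_inequality xh (erefl xg) al01 Dz lo up.
move: (D _) => D' cpl.
rewrite (dot_sub_diff x' x xh z) (dot_sub_diff y' y yh zy) Ex dotZl.
have -> : w * (dot (y - zy) (y - zy) + 2 * dot (y' - y) (yh - zy)
    + dot (yh - y') (yh - y') - dot (yh - y) (yh - y)) =
  w * dot (y - zy) (y - zy) + 2 * dot (w *: (y' - y)) (yh - zy)
    + w * dot (yh - y') (yh - y') - w * dot (yh - y) (yh - y).
  by rewrite dotZl; ring.
(* The bilinear terms of x and y have opposite signs and cancel once both read
   [dot (xh - z) (B *m (yh - zy))]. *)
rewrite Ey dotZl [dot (_ + B *m _) _]dotDl [dot (g xg + _) _]dotDl dotZl.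
rewrite [dot (_ - _ *m _) _]dotDl dotNl dotZl -dot_mulmx.
rewrite (dotC (B *m _)).
have := dot_sub_le x xh z; have := dot_sub_le y yh zy.
have := dot_ge0 (xh - z); have := dot_ge0 (yh - zy).
have := dot_ge0 (xh - x); have := dot_ge0 (yh - y).
have := dot_ge0 (x - z); have := dot_ge0 (y - zy).
have := D0 xf; move: (D xf) acc cpl.
move: (dot (xh - x') _) (dot (yh - y') _) (dot (g xg) _) (dot (xh - z) (B *m _)).
move: (dot (xh - z) _) (dot (yh - zy) _) (dot (xh - x) _) (dot (yh - y) _)
  (dot (x - z) _) (dot (y - zy) _).
move=> a b s t X Y e f ga c Df acc cpl Df0 Y0 X0 t0 s0 b0 a0 hY hX.
have cpl2 : 2 * eta / al * (D' - (1 - al) * Df) - L * al * eta * s <= 2 * eta * ga.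
  have -> : L * al * eta * s = 2 * eta / al * (L / 2 * al ^+ 2 * s) by field; rewrite gt_eqF.
  have -> : 2 * eta * ga = 2 * eta / al * (al * ga) by field; rewrite gt_eqF.
  rewrite -mulrBr ler_wpM2l // divr_ge0 ?mulr_ge0 // ltW //.
(* The gain [- s] is spent completely: 1/6 on the inexactness [acc], 1/3 on smoothness, and 1/2 on
   turning the decrease measured at [xh] into one measured at [x]. The gain in y has 1/3 to
   spare. *)
have h1 : L * al * eta * s <= s / 3.
  by have := ler_wpM2r s0 Leta; lra.
have h2 : al / 4 * X <= 2 * (mu * eta) * a + s / 2.
  have m1 := ler_wpM2r X0 almu; have m2 := ler_wpM2r s0 mueta.
  have m0 : 0 <= mu * eta by rewrite mulr_ge0.
  have m3 := ler_wpM2l m0 hX; have m4 := mulr_ge0 m0 a0; lra.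
have h3 : al / 4 * Y <= 2 * (mu * eta) * b + t / 2.
  have m1 := ler_wpM2r Y0 almu; have m2 := ler_wpM2r t0 mueta.
  have m0 : 0 <= mu * eta by rewrite mulr_ge0.
  have m3 := ler_wpM2l m0 hY; have m4 := mulr_ge0 m0 b0; lra.
have h4 := ler_wpM2l w0 h3; have h5 := mulr_ge0 w0 t0.
have h6 : 2 * eta / al * (al / 4 * Df) <= 2 * eta / al * (al * Df).
  apply: ler_wpM2l; first by rewrite divr_ge0 ?mulr_ge0 // ltW.
  by apply: ler_wpM2r => //; lra.
lra.
Qed.

End Acceleration.

Section GradientMethod.
Context {R : realType} {n : nat}.
Variables (al eta m s : R) (w : 'cV[R]_n).

(** The part [m] of the quadratic form is treated implicitly, whence the factor [(1 + eta * m)^-1];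
    the rest, including [- m *: xg], is evaluated at [xg]. *)
Fixpoint agd (N : nat) (x xf : 'cV[R]_n) : prog matop 'cV[R]_n 'cV[R]_n :=
  match N with
  | 0%N => Ret x
  | N'.+1 =>
    let xg := al *: x + (1 - al) *: xf in
    Call MulBT xg (fun t => Call MulB t (fun u =>
    let x' := (1 + eta * m)^-1 *: (x - eta *: (s *: xg + u - w - m *: xg)) in
    agd N' x' (xg + al *: (x' - x))))
  end.

Definition matvec (B : 'M[R]_n) (o : matop) (v : 'cV[R]_n) :=
  match o with MulB => B *m v | MulBT => B^T *m v end.

Lemma calls_agd O N x xf : calls predT O (agd N x xf) = (2 * N)%N.
Proof. by elim: N x xf => //= N IH x xf; rewrite IH mulnS. Qed.

Lemma run_agd B (l : R) (z : 'cV[R]_n) :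
  0 < al <= 1 -> 0 < eta -> 0 < m ->
  al <= 3 * m * eta -> 3 * m * eta <= 1 -> 3 * l * al * eta <= 1 ->
  0 <= s ->
  (forall v, m * dot v v <= dot v (B *m B^T *m v)) ->
  (forall v, s * dot v v + dot v (B *m B^T *m v) <= l * dot v v) ->
  s *: z + B *m B^T *m z = w ->
  forall N x, let xh := run (matvec B) (agd N x x) in
  dot (xh - z) (xh - z) <=
    (1 - al / 4) ^+ N * ((1 + eta / al * l) * dot (x - z) (x - z)).
Proof.
move=> /andP[al0 al1] eta0 m0 h1 h2 h3 s0 lo up wz N x.
pose g (v : 'cV[R]_n) := (s - m) *: (v - z) + B *m B^T *m (v - z).
pose D v := dot (v - z) (g v) / 2.
have symA : (B *m B^T)^T = B *m B^T by rewrite trmx_mul trmxK.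
have gap (a b : 'cV[R]_n) : D b - D a - dot (g a) (b - a) =
    ((s - m) * dot (b - a) (b - a) + dot (b - a) (B *m B^T *m (b - a))) / 2.
  have [e Ee] : exists e, e = b - a by exists (b - a).
  have [c Ec] : exists c, c = a - z by exists (a - z).
  have Eb : b - z = c + e by rewrite Ee Ec [RHS]addrC subrKA.
  rewrite /D /g Eb -Ec -Ee mulmxDr !dot_linear (dotC e c).
  by rewrite (dot_mulmx (B *m B^T) c e) symA (dotC (B *m B^T *m c) e); field.
have Dlo a b : D a + dot (g a) (b - a) <= D b.
  rewrite -subr_ge0 opprD addrA gap divr_ge0 //.
  by have := lo (b - a); have := mulr_ge0 s0 (dot_ge0 (b - a)); lra.
have Dup a b : D b <= D a + dot (g a) (b - a) + l / 2 * dot (b - a) (b - a).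
  rewrite -lerBlDl opprD addrA gap.
  by have := up (b - a); have := mulr_ge0 (ltW m0) (dot_ge0 (b - a)); lra.
have Dz : D z = 0 by rewrite /D subrr dot0l mul0r.
have D0 a : 0 <= D a.
  by have := Dlo z a; rewrite Dz /g subrr scaler0 mulmx0 addr0 dot0l addr0.
have q0 : 0 <= 1 - al / 4 by lra.
have eta_al : 0 <= 2 * eta / al by rewrite divr_ge0 ?mulr_ge0 // ltW.
have main xf : let xh := run (matvec B) (agd N x xf) in
  dot (xh - z) (xh - z) <=
    (1 - al / 4) ^+ N * (dot (x - z) (x - z) + 2 * eta / al * D xf).
  elim: N x xf => [|N IH] y yf /=.
    by rewrite expr0 mul1r lerDl mulr_ge0.
  set yg := al *: y + (1 - al) *: yf.
  set y' := (1 + eta * m)^-1 *: _.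
  apply: le_trans (IH _ _) _; rewrite exprSr -[leRHS]mulrA.
  apply: ler_wpM2l; first exact: exprn_ge0.
  have Ey : y' - y = - eta *: (g yg + m *: (y' - z) + (0 : 'M[R]_n) *m (0 - 0)).
    have k0 : 1 + eta * m != 0 by rewrite gt_eqF // ltr_wpDr ?mulr_ge0 // ltW.
    have : (1 + eta * m) *: y' = y - eta *: (s *: yg + B *m (B^T *m yg) - w - m *: yg).
      by rewrite scalerA divff // scale1r.
    rewrite mul0mx addr0 -wz /g mulmxBr -!mulmxA.
    move: (B *m _) (B *m _) => c1 c2 /colP E; apply/colP => i.
    by have := E i; rewrite !mxE; lra.
  (* The y-part is switched off by [w = 0] and a zero matrix. The implicit step is exact, so [xh]
     and [x'] coincide and the accuracy condition is trivial. *)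
  have := @extragradient_contraction R n D g 0 l m 0 al eta y yf y' y' 0 0 0 z 0.
  rewrite al0 al1 lexx !mul0r !addr0 => h.
  apply: h => //.
  - exact: ltW.
  - exact: ltW.
  - by rewrite subrr trmx0 mul0mx !scaler0 subrr scaler0.
  - by rewrite subrr dot0l divr_ge0 // dot_ge0.
apply: le_trans (main x) _.
apply: ler_wpM2l; first exact: exprn_ge0.
have := Dup z x; rewrite Dz /g subrr scaler0 mulmx0 addr0 dot0l !add0r => h.
have := ler_wpM2l eta_al h.
have -> : 2 * eta / al * (l / 2 * dot (x - z) (x - z)) = eta / al * l * dot (x - z) (x - z).
  by field; rewrite gt_eqF.
lra.
Qed.
End GradientMethod.

(** * Programs, gradients and step sizes *)

Section Programs.
Context {Op Op' V A A' : Type}.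

Lemma run_bind (O : Op -> V -> V) (m : prog Op V A) (f : A -> prog Op V A') :
  run O (bind m f) = run O (f (run O m)).
Proof. by elim: m => //= o v k IH; rewrite IH. Qed.

Lemma run_lift (O : Op' -> V -> V) (h : Op -> Op') (m : prog Op V A) :
  run O (Defs.lift h m) = run (fun o => O (h o)) m.
Proof. by elim: m => //= o v k IH; rewrite IH. Qed.

Lemma calls_bind sel (O : Op -> V -> V) (m : prog Op V A) (f : A -> prog Op V A') :
  calls sel O (bind m f) = (calls sel O m + calls sel O (f (run O m)))%N.
Proof. by elim: m => //= o v k IH; rewrite IH addnA. Qed.

Lemma calls_lift sel (O : Op' -> V -> V) (h : Op -> Op') (m : prog Op V A) :
  calls sel O (Defs.lift h m) = calls (fun o => sel (h o)) (fun o => O (h o)) m.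
Proof. by elim: m => //= o v k IH; rewrite IH. Qed.
End Programs.

Section SubproblemGradients.
Context {R : realType} {n : nat}.
Variables (P : params R) (eps : R) (p : 'cV[R]_n -> R) (B : 'M[R]_n) (c : 'cV[R]_n).
Implicit Types (x y xg yg xk yk : 'cV[R]_n).

Lemma grad_q_tilde y : D_y P != 0 -> grad (q_tilde P eps c) y = c.
Proof.
move=> D0; apply: (grad_quadratic (b := fun=> 0)) => i h.
have E z : q_tilde P eps c z = dot z c by rewrite /q_tilde /q_reg /mu_q; field.
by rewrite !E dotDl dotZl dotC -dotC (dotC _ c) dot_delta mulr0 addr0 addrC.
Qed.

Lemma grad_p_tilde x : differentiable p x ->
  grad (p_tilde P p) x = grad p x - mu_p P *: x.
Proof.
move=> dp; apply/colP => i; rewrite !mxE.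
have dp' : is_derive x (delta_mx i 0) p ('D_(delta_mx i 0) p x).
  by split => //; exact: diff_derivable.
have dq : is_derive x (delta_mx i 0) (fun z => mu_p P / 2 * enorm z ^+ 2) (mu_p P * x i 0).
  apply: (derive_quadratic (b := mu_p P / 2)) => h.
  rewrite !enorm_sqr !dot_linear dot_delta (dotC _ x) !dot_delta mxE !eqxx.
  by rewrite mulr1n; field.
by have [_ ->] := is_deriveB dp' dq.
Qed.

Lemma grad_A_eta_x xg yg xk yk x y : eta_x P != 0 ->
  grad (fun x => A_eta P eps p B c xg yg xk yk x y) x =
  grad (p_tilde P p) xg + (eta_x P)^-1 *: (x - xk) + (mu_p P *: x + B *m y).
Proof.
move=> e0.
apply: (grad_quadratic (b := fun=> 1 / (2 * eta_x P) + mu_p P / 2)) => i h.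
rewrite /A_eta /R_fun !enorm_sqr -addrA !dot_linear !(dotC (delta_mx i 0)).
by rewrite !dot_delta (dotC xk x) !mxE !eqxx mulr1n; move: (1 / (2 * eta_y P eps)) => r; field.
Qed.

Lemma grad_A_eta_y xg yg xk yk x y : eta_y P eps != 0 ->
  grad (fun y => A_eta P eps p B c xg yg xk yk x y) y =
  B^T *m x - mu_q P eps *: y - grad (q_tilde P eps c) yg
  - (eta_y P eps)^-1 *: (y - yk).
Proof.
move=> e0.
apply: (grad_quadratic (b := fun=> - (1 / (2 * eta_y P eps) + mu_q P eps / 2))) => i h.
rewrite /A_eta /R_fun !enorm_sqr -addrA !dot_mulmx !dot_linear !(dotC (delta_mx i 0)).
by rewrite !dot_delta (dotC yk y) !mxE !eqxx mulr1n; move: (1 / (2 * eta_x P)) => r; field.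
Qed.
End SubproblemGradients.

Section StepSizeBounds.
Context {R : realType}.
Variables (P : params R).
Hypotheses (mu0 : 0 < mu_p P) (muL : mu_p P <= L_p P).

Let L0 : 0 < L_p P. Proof. exact: lt_le_trans muL. Qed.

Lemma alphaE : alpha P = Num.sqrt (mu_p P / L_p P).
Proof.
rewrite /alpha min_r // -sqrtr1 ler_sqrt //.
by rewrite ler_pdivrMr // mul1r.
Qed.

Lemma alpha_bound : 0 < alpha P <= 1.
Proof. by rewrite {1}alphaE sqrtr_gt0 divr_gt0 //= /alpha ge_min lexx. Qed.

Lemma alpha_sqr : L_p P * alpha P ^+ 2 = mu_p P.
Proof.
rewrite alphaE sqr_sqrtr ?divr_ge0 ?ltW //.
by rewrite mulrC divfK // gt_eqF.
Qed.

(** The second bound in the minimum is the active one because mu_p = L_p alpha^2 <= L_p alpha. *)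
Lemma eta_xE : eta_x P = 1 / (3 * L_p P * alpha P).
Proof.
have /andP[a0 a1] := alpha_bound.
rewrite /eta_x min_r // !div1r lef_pV2 ?posrE ?mulr_gt0 //.
rewrite -mulrA ler_pM2l // -alpha_sqr expr2 mulrA.
by rewrite ler_piMr // ltW // mulr_gt0.
Qed.

Lemma eta_x_gt0 : 0 < eta_x P.
Proof. by have /andP[a0 _] := alpha_bound; rewrite eta_xE divr_gt0 ?mulr_gt0. Qed.

Lemma L_alpha_eta : 3 * L_p P * alpha P * eta_x P = 1.
Proof.
have /andP[a0 _] := alpha_bound.
by rewrite eta_xE; field; rewrite !gt_eqF.
Qed.

(** Together with [L_alpha_eta], it turns two step size conditions of [extragradient_contraction]
    into equalities; the third becomes alpha <= 1. *)
Lemma mu_eta : 3 * mu_p P * eta_x P = alpha P.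
Proof.
rewrite -alpha_sqr; transitivity (alpha P * (3 * L_p P * alpha P * eta_x P)); first by ring.
by rewrite L_alpha_eta mulr1.
Qed.
End StepSizeBounds.

(** * The inner solver *)

(** Uses 1 - q / 4 <= exp (- q / 4). *)
Lemma geometric_decay {R : realType} (q X : R) (N : nat) :
  0 < q <= 1 -> 0 < X -> 4 / q * ln X <= N%:R -> (1 - q / 4) ^+ N * X <= 1.
Proof.
move=> /andP[q0 q1] X0 XN.
have e1 : (1 - q / 4) ^+ N <= expR (- (q / 4) * N%:R).
  rewrite expRM_natr; apply: lerXn2r; rewrite ?nnegrE ?expR_ge0 //; first by lra.
  exact: expR_ge1Dx.
apply: le_trans (ler_wpM2r (ltW X0) e1) _.
rewrite -[X in _ * X]lnK ?posrE // -expRD -[leRHS]expR0 ler_expR.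
have := ler_wpM2l (ltW (_ : 0 < q / 4)) XN; rewrite divr_gt0 // => /(_ isT).
have -> : q / 4 * (4 / q * ln X) = ln X by field; rewrite gt_eqF.
lra.
Qed.

Section Solver.
Context {R : realType}.
Variables (P : params R) (eps : R).

(* The Schur complement [coef_x coef_y + B B^T] of a subproblem has its spectrum
   in [lam_min, 2 lam_max]; [alpha] and [eta_x] at these parameters are the step
   sizes of the inner iteration. *)
Definition inner_params : params R :=
  Params (lam_min P) (2 * lam_max P) (D_y P) (lam_max P) (lam_min P).

(** Stationarity of a subproblem reads coef_x x + B y = u and coef_y y - B^T x = v, with [u] and [v]
    as in [solver]. Eliminating y gives (coef_x coef_y + B B^T) x = coef_y u - B v. *)
Definition coef_x : R := mu_p P + (eta_x P)^-1.
Definition coef_y : R := mu_q P eps + (eta_y P eps)^-1.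

(** Over eps^2, this bounds the reduction of the squared error required from the inner method;
    [inner_decay] uses the two summands 4 and 24 (...)^2. *)
Definition inner_factor : R :=
  (1 + eta_x inner_params / alpha inner_params * (2 * lam_max P)) *
  (4 + 24 * (eta_x P * (2 * lam_max P) / (coef_x / (8 * D_y P ^+ 2 * mu_p P))) ^+ 2).

(** The summand e makes ln (inner_M / eps) at least 1 for eps <= 1; the absolute value keeps
    [inner_M] positive for arbitrary parameters. *)
Definition inner_M : R := expR 1 + `|inner_factor|.

Definition inner_steps : nat :=
  (Num.truncn (4 / alpha inner_params * (2 * ln (inner_M / eps)))).+1.

End Solver.

Definition solver (R : realType) : inner_method R := fun n P eps gp gq xk yk =>
  let u := (eta_x P)^-1 *: xk - gp in
  let v := (eta_y P eps)^-1 *: yk - gq in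
  Call MulB v (fun Bv =>
  bind (agd (alpha (inner_params P)) (eta_x (inner_params P)) (lam_min P)
          (coef_x P * coef_y P eps) (coef_y P eps *: u - Bv)
          (inner_steps P eps) xk xk) (fun xh =>
  Call MulBT xh (fun BTxh =>
  Ret (xh, (coef_y P eps)^-1 *: (v + BTxh))))).

Lemma calls_solver (R : realType) n (P : params R) eps (gp gq xk yk : 'cV[R]_n) O :
  calls predT O (solver P eps gp gq xk yk) = (2 * inner_steps P eps + 2)%N.
Proof.
rewrite /solver; move: (inner_steps P eps) => N /=.
by rewrite calls_bind calls_agd /= add1n addn1 addn2.
Qed.

Section Subproblem.
Context {R : realType} {n : nat}.
Variables (P : params R) (eps : R) (B : 'M[R]_n).
Hypotheses (mu0 : 0 < mu_p P) (muL : mu_p P <= L_p P) (D0 : 0 < D_y P).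
Hypotheses (lmin0 : 0 < lam_min P) (lminmax : lam_min P <= lam_max P).
Hypotheses (lminB : forall v, lam_min P * dot v v <= dot v (B *m B^T *m v)).
Hypotheses (lmaxB : forall v, dot v (B *m B^T *m v) <= lam_max P * dot v v).
Hypotheses (eps0 : 0 < eps) (eps1 : eps <= 1).
Hypotheses (coef_le : coef_x P * coef_y P eps <= lam_max P).
Implicit Types (x y xk yk gp gq z v w : 'cV[R]_n).

Let lmax0 : 0 < lam_max P. Proof. exact: lt_le_trans lminmax. Qed.
Let mu_q0 : 0 < mu_q P eps. Proof. by rewrite divr_gt0 ?mulr_gt0 ?exprn_gt0. Qed.

Let inner_mu_le : mu_p (inner_params P) <= L_p (inner_params P).
Proof. by apply: le_trans lminmax _; rewrite /= ler_peMl ?ler1n // ltW. Qed.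

Lemma coef_x_gt0 : 0 < coef_x P.
Proof. by rewrite addr_gt0 ?invr_gt0 ?eta_x_gt0. Qed.

(** The choice of [eta_y] gives coef_y = (mu_q / mu_p) coef_x, which is linear in eps. *)
Lemma coef_yE : coef_y P eps = eps * (coef_x P / (8 * D_y P ^+ 2 * mu_p P)).
Proof.
have := eta_x_gt0 mu0 muL => e0.
by rewrite /coef_y /coef_x /eta_y /mu_q; field; rewrite !gt_eqF.
Qed.

Lemma coef_y_gt0 : 0 < coef_y P eps.
Proof. by rewrite coef_yE mulr_gt0 // divr_gt0 ?coef_x_gt0 // !mulr_gt0 ?exprn_gt0. Qed.

(** The system is the stationarity condition of the strongly convex quadratic [f]. *)
Lemma schur_solution w : exists z,
  (coef_x P * coef_y P eps) *: z + B *m B^T *m z = w.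
Proof.
set s := _ * _; have s0 : 0 < s by rewrite mulr_gt0 ?coef_x_gt0 ?coef_y_gt0.
have symA : (B *m B^T)^T = B *m B^T by rewrite trmx_mul trmxK.
set A := B *m B^T in symA *.
pose f v := (s * dot v v + dot v (A *m v)) / 2 - dot w v.
pose g v := s *: v + A *m v - w.
have gap (x y : 'cV[R]_n) : f y - f x - dot (g x) (y - x) =
    (s * dot (y - x) (y - x) + dot (y - x) (A *m (y - x))) / 2.
  have [e Ee] : exists e, e = y - x by exists (y - x).
  have -> : y = x + e by rewrite Ee addrC subrK.
  rewrite /f /g [x + e - x]addrAC subrr add0r mulmxDr !dot_linear (dotC e x).
  by rewrite (dot_mulmx A x e) symA (dotC (A *m x) e); field.
have [|||z gz] := @exists_stationary R n (lam_min P) (2 * lam_max P) f g lmin0.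
- by rewrite mulr_gt0.
- move=> x y; rewrite -subr_ge0 opprD opprD !addrA gap.
  by have := lminB (y - x); have := mulr_ge0 (ltW s0) (dot_ge0 (y - x)); rewrite -/A; lra.
- move=> x y; rewrite -lerBlDl opprD addrA gap.
  have := lmaxB (y - x); have := ler_wpM2r (dot_ge0 (y - x)) coef_le.
  by rewrite -/A -/s; lra.
by exists z; apply/eqP; rewrite -subr_eq0; apply/eqP.
Qed.

(** [K] is the reduction of the squared error achieved by [agd]. The part 4 K <= 1 lets
    [solver_accurate] compare the initial error with the step [xh - xk]; the part with 24 makes the
    residual small. *)
Lemma inner_decay (K : R) : K = (1 - alpha (inner_params P) / 4) ^+ inner_steps P eps *
    (1 + eta_x (inner_params P) / alpha (inner_params P) * (2 * lam_max P)) ->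
  0 <= K /\ K * (4 + 24 * (eta_x P * (2 * lam_max P) / coef_y P eps) ^+ 2) <= 1.
Proof.
move EN: (inner_steps P eps) => N EK.
have al01 : 0 < alpha (inner_params P) <= 1 by apply: alpha_bound.
have /andP[al0 al1] := al01.
have ie0 : 0 < eta_x (inner_params P) by apply: eta_x_gt0.
set T := 1 + eta_x _ / _ * _ in EK.
have T1 : 1 <= T by rewrite lerDl mulr_ge0 ?divr_ge0 ?mulr_ge0 // ltW.
split.
  by rewrite EK mulr_ge0 ?exprn_ge0 //; lra.
have M1 : 1 <= inner_M P.
  by apply: ler_wpDr => //; rewrite -expR0 ler_expR.
have Meps : 0 < inner_M P / eps by rewrite divr_gt0 // (lt_le_trans ltr01).
apply: (@le_trans _ _ ((1 - alpha (inner_params P) / 4) ^+ N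
    * (inner_M P / eps) ^+ 2)); last first.
  apply: geometric_decay; rewrite ?exprn_gt0 //.
  rewrite lnXn // -[ln _ *+ 2]mulr_natl; by rewrite -EN; exact/ltW/truncnS_gt.
have q0 : 0 <= 1 - alpha (inner_params P) / 4 by lra.
rewrite EK -[leLHS]mulrA; apply: ler_wpM2l; first exact: exprn_ge0.
rewrite coef_yE [leRHS]expr_div_n.
set be := coef_x P / _.
have be0 : 0 < be by rewrite divr_gt0 ?coef_x_gt0 // !mulr_gt0 ?exprn_gt0.
rewrite ler_pdivlMr ?exprn_gt0 //.
apply: (@le_trans _ _ (inner_factor P)).
  rewrite /inner_factor -/T -/be -[leLHS]mulrA; apply: ler_wpM2l; first by lra.
  set e := eta_x P * _.
  have -> : (4 + 24 * (e / (eps * be)) ^+ 2) * eps ^+ 2 = 4 * eps ^+ 2 + 24 * (e / be) ^+ 2.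
    by field; rewrite !gt_eqF.
  by rewrite lerD2r -[leRHS]mulr1 ler_wpM2l // exprn_ile1 // ltW.
apply: (@le_trans _ _ (inner_M P)).
  by apply: le_trans (ler_norm _) _; rewrite lerDr expR_ge0.
by rewrite expr2 ler_peMl // (le_trans ler01).
Qed.

Lemma solver_accurate gp gq xk yk :
  let xyh := run (matvec B) (solver P eps gp gq xk yk) in
  let ex := gp + (eta_x P)^-1 *: (xyh.1 - xk) + (mu_p P *: xyh.1 + B *m xyh.2) in
  eta_x P ^+ 2 * dot ex ex <= dot (xyh.1 - xk) (xyh.1 - xk) / 6 /\
  B^T *m xyh.1 - mu_q P eps *: xyh.2 - gq - (eta_y P eps)^-1 *: (xyh.2 - yk) = 0.
Proof.
rewrite /solver; move EN: (inner_steps P eps) => N /=; rewrite run_bind /=.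
set v := (eta_y P eps)^-1 *: yk - gq; set u := (eta_x P)^-1 *: xk - gp.
set w := coef_y P eps *: u - B *m v.
set xh := run _ _; set yh := (coef_y P eps)^-1 *: _.
have b0 := coef_y_gt0; have a0 := coef_x_gt0.
have Eyh : coef_y P eps *: yh = v + B^T *m xh by rewrite /yh [LHS]scalerA divff ?gt_eqF // scale1r.
split; last first.
  apply/colP => i; have /colP/(_ i) := Eyh.
  by rewrite /v /coef_y !mxE; lra.
have [z Ez] := schur_solution w.
have al01 : 0 < alpha (inner_params P) <= 1 by apply: alpha_bound.
have ie0 : 0 < eta_x (inner_params P) by apply: eta_x_gt0.
have ab0 : 0 <= coef_x P * coef_y P eps by rewrite mulr_ge0 // ltW.
have up t : coef_x P * coef_y P eps * dot t t + dot t (B *m B^T *m t) <= 2 * lam_max P * dot t t.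
  by have := lmaxB t; have := ler_wpM2r (dot_ge0 t) coef_le; lra.
have := run_agd al01 ie0 lmin0 _ _ _ ab0 lminB up Ez N xk.
rewrite -[lam_min P]/(mu_p (inner_params P)) -[2 * lam_max P]/(L_p (inner_params P)).
rewrite mu_eta // L_alpha_eta // lexx => /(_ isT (proj2 (andP al01)) (lexx _)).
rewrite /= -/xh [leRHS]mulrA.
set K := _ * (1 + eta_x _ / _ * _) => hK.
have [|K0 K1] := @inner_decay K; first by rewrite EN.
set ex := gp + _ + _.
(* As the y-residual vanishes, [coef_y] times the x-residual is the residual of the eliminated
   system. *)
have Eex : coef_y P eps *: ex =
    (coef_x P * coef_y P eps)%:M *m (xh - z) + B *m B^T *m (xh - z).
  have : coef_y P eps *: (B *m yh) = B *m v + B *m (B^T *m xh).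
    by rewrite scalemxAr Eyh mulmxDr.
  have -> : (coef_x P * coef_y P eps)%:M *m (xh - z) + B *m B^T *m (xh - z) =
      (coef_x P * coef_y P eps) *: xh + B *m (B^T *m xh) - w.
    rewrite -Ez mul_scalar_mx scalerBr mulmxBr addrACA -opprD.
    by rewrite -[B *m B^T *m xh]mulmxA.
  rewrite /w /ex /u /coef_x.
  move: (B *m yh) (B *m v) => c1 c2 /colP E; apply/colP => i.
  have := E i; rewrite !mxE => h.
  by lra.
pose S := (coef_x P * coef_y P eps)%:M + B *m B^T.
have SE t : dot t (S *m t) = coef_x P * coef_y P eps * dot t t + dot t (B *m B^T *m t).
  by rewrite mulmxDl mul_scalar_mx dotDr dotZr.
have symS : S^T = S by rewrite linearD /= tr_scalar_mx trmx_mul trmxK.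
have psdS t : 0 <= dot t (S *m t).
  rewrite SE; have := lminB t; have := mulr_ge0 ab0 (dot_ge0 t).
  by have := mulr_ge0 (ltW lmin0) (dot_ge0 t); lra.
have upS t : dot t (S *m t) <= 2 * lam_max P * dot t t by rewrite SE.
have l0 : 0 < 2 * lam_max P by rewrite mulr_gt0.
have exle : coef_y P eps ^+ 2 * dot ex ex <= (2 * lam_max P) ^+ 2 * dot (xh - z) (xh - z).
  have -> : coef_y P eps ^+ 2 * dot ex ex = dot (S *m (xh - z)) (S *m (xh - z)).
    by rewrite /S [_ *m _]mulmxDl -Eex dotZl dotZr mulrA.
  apply: le_trans (psd_sqr_le l0 symS psdS upS _) _.
  by rewrite expr2 -[leRHS]mulrA ler_pM2l.
have tri := dot_sub_le xk xh z.
have c0 : 0 <= (eta_x P * (2 * lam_max P) / coef_y P eps) ^+ 2 by exact: sqr_ge0.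
have Kz0 := mulr_ge0 K0 (dot_ge0 (xk - z)).
(* Since |xh - z|^2 is at most a quarter of |xk - z|^2, the triangle inequality [tri] absorbs it.
   The final constant is 4 / 24 = 1 / 6. *)
have z4 : dot (xk - z) (xk - z) <= 4 * dot (xh - xk) (xh - xk).
  have : 4 * K <= 1 by have := mulr_ge0 K0 c0; lra.
  move=> /(ler_wpM2r (dot_ge0 (xk - z))); lra.
have -> : eta_x P ^+ 2 * dot ex ex =
    (eta_x P / coef_y P eps) ^+ 2 * (coef_y P eps ^+ 2 * dot ex ex).
  by field; rewrite gt_eqF.
apply: le_trans (ler_wpM2l (sqr_ge0 _) exle) _.
rewrite [leLHS](_ : _ = (eta_x P * (2 * lam_max P) / coef_y P eps) ^+ 2 *
  dot (xh - z) (xh - z)); last by field; rewrite gt_eqF.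
apply: le_trans (ler_wpM2l c0 hK) _.
have K24 : K * (24 * (eta_x P * (2 * lam_max P) / coef_y P eps) ^+ 2) <= 1 by lra.
have := ler_wpM2r (dot_ge0 (xk - z)) K24.
lra.
Qed.
End Subproblem.

(** * Regularization and the outer loop *)

Section Regularization.
Context {R : realType} {n : nat}.
Variables (p : 'cV[R]_n -> R) (B : 'M[R]_n) (c : 'cV[R]_n) (mu L : R).
Hypotheses (mu0 : 0 < mu) (sp : smooth L p) (cp : strongly_convex mu p).
Implicit Types (x y v xs ys xr yr : 'cV[R]_n).

Lemma strongly_convex_le_smooth v : v != 0 -> mu <= L.
Proof.
move=> /dot_gt0 v0.
have := le_trans (strongly_convex_grad 0 v sp cp) (smooth_descent 0 v sp).
by rewrite subr0 lerD2l ler_pM2r // ler_pM2r // invr_gt0.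
Qed.

Lemma strongly_monotone_grad x y :
  mu * dot (x - y) (x - y) <= dot (grad p x - grad p y) (x - y).
Proof.
have := strongly_convex_grad x y sp cp; have := strongly_convex_grad y x sp cp.
by rewrite -(opprB x y) [dot (grad p x - _) _]dotDl !dotNr !dotNl; lra.
Qed.

Lemma saddle_point_stationary xs ys : 0 < L ->
  saddle_point (saddle_obj p B c) xs ys ->
  grad p xs + B *m ys = 0 /\ B^T *m xs = c.
Proof.
move=> L0 sd; split.
  apply: (@stationary_of_min _ _ L (fun x => p x + dot x (B *m ys)) _ xs L0) => x.
    have := smooth_descent xs x sp.
    rewrite [dot (grad p xs + _) _]dotDl [dot (B *m ys) (x - xs)]dotC.
    by rewrite [dot (x - xs) (B *m ys)]dotDl dotNl; lra.
  by have := (sd x 0).2; rewrite /saddle_obj; lra.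
apply/eqP; rewrite -subr_eq0 -dot_eq0 eq_le dot_ge0 andbT.
(* The objective is linear in y, so moving along its slope in y would increase it unless the slope
   is 0. *)
have := (sd 0 (ys + (B^T *m xs - c))).1.
rewrite /saddle_obj mulmxDr; move Er: (B^T *m xs - c) => r.
rewrite !dot_linear (dot_mulmx B xs r) (dotC r c).
by rewrite -[X in dot X _ <= _]Er dotDl dotNl; lra.
Qed.

(** Maximizing over y gives y = (B^T x - c) / nu. What remains is [f], which is [mu]-strongly convex
    and has smoothness constant [L + l / nu]. *)
Lemma exists_regularized_solution (nu l : R) : 0 < L -> 0 < nu -> 0 < l ->
  (forall v, 0 <= dot v (B *m B^T *m v)) ->
  (forall v, dot v (B *m B^T *m v) <= l * dot v v) ->
  exists xr yr, grad p xr + B *m yr = 0 /\ B^T *m xr - c = nu *: yr.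
Proof.
move=> L0 nu0 l0 lo up.
pose res x := B^T *m x - c.
pose f x := p x + dot (res x) (res x) / (2 * nu).
pose g x := grad p x + B *m (nu^-1 *: res x).
have gap x y : f y - f x - dot (g x) (y - x) =
    p y - p x - dot (grad p x) (y - x) + dot (y - x) (B *m B^T *m (y - x)) / (2 * nu).
  have [e Ee] : exists e, e = y - x by exists (y - x).
  have Ey : y = x + e by rewrite Ee addrC subrK.
  rewrite -Ee -mulmxA (dot_mulmx _ e) /f /g.
  have -> : res y = res x + B^T *m e by rewrite /res Ey mulmxDr addrAC.
  rewrite [dot (grad p x + _) e]dotDl [dot (B *m _) e]dotC (dot_mulmx _ e) dotZr.
  move: (B^T *m e) (res x) => b r; rewrite !dot_linear (dotC b r).
  by field; rewrite gt_eqF.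
have [|||x gx] := @exists_stationary R n mu (L + l / nu) f g mu0.
- by rewrite addr_gt0 ?divr_gt0.
- move=> x y; rewrite -subr_ge0 opprD opprD !addrA gap.
  have := strongly_convex_grad x y sp cp.
  have : 0 <= dot (y - x) (B *m B^T *m (y - x)) / (2 * nu).
    by rewrite divr_ge0 // mulr_ge0 // ltW.
  lra.
- move=> x y; rewrite -lerBlDl opprD addrA gap.
  have := smooth_descent x y sp.
  have : dot (y - x) (B *m B^T *m (y - x)) / (2 * nu) <= l / nu / 2 * dot (y - x) (y - x).
    rewrite ler_pdivrMr ?mulr_gt0 //; apply: le_trans (up _) _.
    by rewrite le_eqVlt; apply/orP; left; apply/eqP; field; rewrite gt_eqF.
  lra.
exists x, (nu^-1 *: res x); split => //.
by rewrite scalerA divff ?scale1r // gt_eqF.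
Qed.

Lemma posdef_unitmx : posdef B -> B \in unitmx.
Proof.
move=> pB; rewrite -unitmx_tr -row_free_unit -kermx_eq0.
apply/eqP/row_matrixP => i; rewrite row0.
set u := row i _; have uB : u *m B^T = 0 by rewrite /u -row_mul mulmx_ker row0.
have Bu : B *m u^T = 0 by rewrite -[B]trmxK -trmx_mul uB trmx0.
apply/eqP; rewrite -trmx_eq0; apply: contraT => /pB.
by rewrite Bu dotC dot0l ltxx.
Qed.

(* [B] and [B^T] have the same least singular value: pair [B v] with
   the preimage of [v] under [B^T]. *)
Lemma mulmx_lower_bound (l : R) : B \in unitmx -> 0 < l ->
  (forall v, l * dot v v <= dot v (B *m B^T *m v)) ->
  forall v, l * dot v v <= dot (B *m v) (B *m v).
Proof.
move=> uB l0 lo v.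
have [->|v0] := eqVneq v 0; first by rewrite dot0l mulr0 dot_ge0.
pose w := invmx B^T *m v.
have Ew : B^T *m w = v by rewrite mulKVmx ?unitmx_tr.
have := lo w; rewrite -mulmxA dot_mulmx Ew => lw.
have := CauchySchwarz_sqr (B *m v) w.
rewrite dotC dot_mulmx Ew => cs.
have vv := dot_gt0 v0.
rewrite -(ler_pM2r vv).
apply: (@le_trans _ _ (l * (dot (B *m v) (B *m v) * dot w w))).
  by rewrite -mulrA -expr2 ler_pM2l.
by rewrite mulrCA ler_wpM2l ?dot_ge0.
Qed.

(** Subtracting the stationarity equations bounds [X] and [Y] by each other: l Y^2 <= L^2 X from the
    singular values of [B], and mu X <= nu Dy Y from monotonicity, where the term - nu |yr - ys|^2
    is dropped. Solving both gives Y <= nu q, so the squared error is of order nu^2. *)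
Lemma regularization_error (nu l Dy q : R) xs ys xr yr :
  q = L ^+ 2 * Dy / (mu * l) ->
  0 < L -> 0 < nu -> 0 < l -> 0 < Dy ->
  (forall v, l * dot v v <= dot (B *m v) (B *m v)) -> enorm ys <= Dy ->
  grad p xs + B *m ys = 0 -> B^T *m xs = c ->
  grad p xr + B *m yr = 0 -> B^T *m xr - c = nu *: yr ->
  dot (xr - xs) (xr - xs) + dot (yr - ys) (yr - ys) <= nu ^+ 2 * (q ^+ 2 + Dy * q / mu).
Proof.
move=> Eq L0 nu0 l0 Dy0 lo ysD gs cs gr cr.
have q0 : 0 < q by rewrite Eq divr_gt0 ?mulr_gt0 ?exprn_gt0.
set X := dot (xr - xs) _; rewrite -(enorm_sqr (yr - ys)); set Y := enorm _.
have X0 : 0 <= X := dot_ge0 _.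
have Y0 : 0 <= Y := enorm_ge0 _.
have Bdy : B *m (yr - ys) = - (grad p xr - grad p xs).
  have Br : B *m yr = - grad p xr by apply/eqP; rewrite -addr_eq0 addrC gr.
  have Bs : B *m ys = - grad p xs by apply/eqP; rewrite -addr_eq0 addrC gs.
  by rewrite mulmxBr Br Bs opprB opprK addrC.
have lY : l * Y ^+ 2 <= L ^+ 2 * X.
  rewrite /Y enorm_sqr; apply: le_trans (lo _) _.
  rewrite Bdy dotNl dotNr opprK -enorm_sqr /X -enorm_sqr -exprMn.
  by rewrite ler_pXn2r ?nnegrE ?mulr_ge0 ?enorm_ge0 ?(ltW L0) //; exact: sp.2.
have muX : mu * X <= nu * (Dy * Y).
  apply: le_trans (strongly_monotone_grad xr xs) _.
  have -> : grad p xr - grad p xs = - (B *m (yr - ys)) by rewrite Bdy opprK.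
  rewrite dotNl dotC dot_mulmx mulmxBr cs cr dotZl -mulrN ler_pM2l //.
  rewrite -{1}(subrK ys yr) dotDl opprD; have := dot_ge0 (yr - ys).
  have := CauchySchwarz (- ys) (yr - ys); rewrite dotNl enormN -/Y.
  by have := ler_wpM2r Y0 ysD; lra.
have Yq : Y <= nu * q.
  have [->|Yn0] := eqVneq Y 0; first by rewrite mulr_ge0 // ltW.
  have Yp : 0 < Y by rewrite lt_def Yn0.
  rewrite Eq mulrA ler_pdivlMr ?mulr_gt0 // -(ler_pM2r Yp).
  have := ler_wpM2l (ltW mu0) lY; have := ler_wpM2l (sqr_ge0 L) muX; lra.
have Xq : X <= nu ^+ 2 * (Dy * q / mu).
  rewrite !mulrA ler_pdivlMr //.
  have := ler_wpM2l (ltW (mulr_gt0 nu0 Dy0)) Yq; lra.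
have : Y ^+ 2 <= (nu * q) ^+ 2.
  by rewrite ler_pXn2r ?nnegrE // mulr_ge0 // ltW.
by rewrite exprMn; lra.
Qed.
End Regularization.

Section OuterLoop.
Context {R : realType} {n : nat}.
Variables (P : params R) (eps : R) (p : 'cV[R]_n -> R) (B : 'M[R]_n)
  (c xr yr : 'cV[R]_n).
Hypotheses (mu0 : 0 < mu_p P) (muL : mu_p P <= L_p P) (D0 : 0 < D_y P).
Hypotheses (sp : smooth (L_p P) p) (cp : strongly_convex (mu_p P) p).
Hypotheses (lmin0 : 0 < lam_min P) (lminmax : lam_min P <= lam_max P).
Hypotheses (lminB : forall v, lam_min P * dot v v <= dot v (B *m B^T *m v)).
Hypotheses (lmaxB : forall v, dot v (B *m B^T *m v) <= lam_max P * dot v v).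
Hypotheses (eps0 : 0 < eps) (eps1 : eps <= 1).
Hypotheses (coef_le : coef_x P * coef_y P eps <= lam_max P).
Hypotheses (gr : grad p xr + B *m yr = 0) (cr : B^T *m xr - c = mu_q P eps *: yr).

Let mu_q0 : 0 < mu_q P eps. Proof. by rewrite divr_gt0 ?mulr_gt0 ?exprn_gt0. Qed.

Definition bregman (x : 'cV[R]_n) : R :=
  p x - p xr - dot (grad p xr) (x - xr) - mu_p P / 2 * dot (x - xr) (x - xr).
Definition bregman_grad (x : 'cV[R]_n) : 'cV[R]_n :=
  grad p x - grad p xr - mu_p P *: (x - xr).

Lemma bregman_diff x y : bregman y - bregman x - dot (bregman_grad x) (y - x) =
  p y - p x - dot (grad p x) (y - x) - mu_p P / 2 * dot (y - x) (y - x).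
Proof.
rewrite /bregman /bregman_grad.
have [e Ee] : exists e, e = y - x by exists (y - x).
have -> : y - xr = (x - xr) + e by rewrite Ee [RHS]addrC subrKA.
rewrite -Ee; move: (x - xr) => d.
by rewrite !dot_linear (dotC e d); field.
Qed.

(** The weight [mu_q / mu_p] is eta_x / eta_y, which gives x and y the same contraction factor. *)
Definition energy (s : state R n) : R :=
  dot (cur_x s - xr) (cur_x s - xr)
  + mu_q P eps / mu_p P * dot (cur_y s - yr) (cur_y s - yr)
  + 2 * eta_x P / alpha P * bregman (cur_xf s).

Lemma bregman_convex x y : bregman x + dot (bregman_grad x) (y - x) <= bregman y.
Proof.
have := bregman_diff x y; have := strongly_convex_grad x y sp cp; lra.
Qed.

Lemma bregman_smooth x y :
  bregman y <= bregman x + dot (bregman_grad x) (y - x) + L_p P / 2 * dot (y - x) (y - x).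
Proof.
have := bregman_diff x y; have := smooth_descent x y sp.
by have := mulr_ge0 (ltW mu0) (dot_ge0 (y - x)); lra.
Qed.

Lemma bregman_center : bregman xr = 0.
Proof. by rewrite /bregman !subrr dot0l dotC dot0l; ring. Qed.

Lemma bregman_ge0 x : 0 <= bregman x.
Proof.
have := bregman_convex xr x.
by rewrite bregman_center /bregman_grad !subrr scaler0 subrr dot0l addr0.
Qed.

Lemma run_iterationE (solve : inner_method R) (s : state R n) :
  run (oracle p B) (iteration solve P eps c s) =
  let gp := grad p (x_g P s) - mu_p P *: x_g P s in
  let gq := grad (q_tilde P eps c) (y_g P s) in
  let xyh := run (matvec B) (solve n P eps gp gq (cur_x s) (cur_y s)) in
  State (cur_x s - eta_x P *: (gp + (mu_p P *: xyh.1 + B *m xyh.2)))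
    (cur_y s - eta_y P eps *: (gq - (B^T *m xyh.1 - mu_q P eps *: xyh.2)))
    (x_g P s + alpha P *: (xyh.1 - cur_x s))
    (y_g P s + alpha P *: (xyh.2 - cur_y s)) xyh.1 xyh.2.
Proof.
rewrite /= run_bind run_lift /=.
by have -> : (fun o => oracle p B (Mat o)) = matvec B by apply/funext => -[].
Qed.

(** The x-residual [ex] of the subproblem plays two roles: it is the gradient in [accurate], and
    eta_x times it is [xh - x']. The accuracy criterion is therefore the inexactness allowed by
    [extragradient_contraction]. *)
Lemma run_iteration (s : state R n) :
  let s' := run (oracle p B) (iteration (@solver R) P eps c s) in
  accurate P eps p B c (x_g P s) (y_g P s) (cur_x s) (cur_y s) (cur_xh s') (cur_yh s')
  /\ energy s' <= (1 - alpha P / 4) * energy s.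
Proof.
have e0 := eta_x_gt0 mu0 muL.
have ey0 : 0 < eta_y P eps by rewrite /eta_y mulr_gt0 // divr_gt0.
have al01 := alpha_bound mu0 muL; have /andP[al0 al1] := al01.
rewrite run_iterationE grad_q_tilde ?gt_eqF //; cbv zeta.
set gp := grad p _ - _.
have [] := solver_accurate mu0 muL D0 lmin0 lminmax lminB lmaxB eps0 eps1 coef_le
  gp c (cur_x s) (cur_y s).
cbv zeta; move: (run _ (solver _ _ _ _ _ _)) => [xh yh] /=; set ex := gp + _ + _ => accx accy.
split.
  rewrite /accurate grad_A_eta_x ?gt_eqF // grad_A_eta_y ?gt_eqF //.
  rewrite grad_q_tilde ?gt_eqF // grad_p_tilde; last exact: sp.1.
  rewrite accy !enorm_sqr dot0l mulr0 addr0 -/gp -/ex.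
  have ey6 : 0 < 1 / (6 * eta_y P eps) by rewrite divr_gt0 // mulr_gt0.
  have := mulr_ge0 (ltW ey6) (dot_ge0 (yh - cur_y s)).
  suff : eta_x P * dot ex ex <= 1 / (6 * eta_x P) * dot (xh - cur_x s) (xh - cur_x s) by lra.
  rewrite -(ler_pM2l e0) mulrA -expr2; apply: le_trans accx _.
  by rewrite le_eqVlt; apply/orP; left; apply/eqP; field; rewrite gt_eqF.
set x' := cur_x s - _; set y' := cur_y s - _.
have Ex' : xh - x' = eta_x P *: ex.
  rewrite /x' /ex; move: (B *m yh) => b; apply/colP => i.
  by rewrite !mxE; field; rewrite gt_eqF.
have Ey' : yh - y' = 0.
  rewrite /y'; move: accy; move: (B^T *m xh) => b /colP E; apply/colP => i.
  have := E i; rewrite !mxE => h.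
  have -> : b i 0 = mu_q P eps * yh i 0 + c i 0 + (eta_y P eps)^-1 * (yh i 0 - cur_y s i 0) by lra.
  by field; rewrite gt_eqF.
have w0 : 0 < mu_q P eps / mu_p P by rewrite divr_gt0.
apply: (@extragradient_contraction R n bregman bregman_grad B (L_p P) (mu_p P)
  (mu_q P eps / mu_p P) (alpha P) (eta_x P) (cur_x s) (cur_xf s) xh x'
  (cur_y s) yh y' xr yr) => //.
- exact: ltW.
- exact: ltW.
- exact: ltW.
- by rewrite mu_eta.
- by rewrite mu_eta.
- by rewrite L_alpha_eta.
- exact: bregman_center.
- exact: bregman_ge0.
- exact: bregman_convex.
- exact: bregman_smooth.
- rewrite /x' /bregman_grad -/(x_g P s) mulmxBr.
  have -> : grad p xr = - (B *m yr) by apply/eqP; rewrite -addr_eq0 gr.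
  rewrite /gp; move: (B *m yh) (B *m yr) (grad p _) => b1 b2 b3.
  by apply/colP => i; rewrite !mxE; ring.
- rewrite /y' mulmxBr.
  have -> : B^T *m xr = mu_q P eps *: yr + c by rewrite -cr subrK.
  rewrite /eta_y; move: (B^T *m xh) => b.
  by apply/colP => i; rewrite !mxE; field; rewrite !gt_eqF.
rewrite Ex' Ey' dot0l mulr0 addr0 !dotZl dotZr mulrA -expr2.
by have := mulr_ge0 (ltW w0) (dot_ge0 (yh - cur_y s)); lra.
Qed.

Lemma run_algorithm (x0 y0 : 'cV[R]_n) K :
  energy (run (oracle p B) (algorithm (@solver R) P eps c x0 y0 K)) <=
  (1 - alpha P / 4) ^+ K * energy (State x0 y0 x0 y0 x0 y0).
Proof.
have /andP[al0 al1] := alpha_bound mu0 muL.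
elim: K => [|K IH]; first by rewrite expr0 mul1r.
rewrite [algorithm _ _ _ _ _ _ _]/= run_bind exprS -mulrA.
apply: le_trans (run_iteration _).2 _.
by apply: ler_wpM2l IH; lra.
Qed.
End OuterLoop.

(** * Complexity *)

Section Complexity.
Context {R : realType}.
Implicit Types (P : params R).

Lemma calls_iteration n (P : params R) eps (p : 'cV[R]_n -> R) B c s :
  calls is_grad (oracle p B) (iteration (@solver R) P eps c s) = 1%N /\
  calls is_mat (oracle p B) (iteration (@solver R) P eps c s) =
    (2 * inner_steps P eps + 4)%N.
Proof.
have split_calls (sel : op -> bool) (solve : inner_method R) :
    calls sel (oracle p B) (iteration solve P eps c s) =
    (sel GradP + (calls (fun o => sel (Mat o)) (fun o => oracle p B (Mat o))
      (solve n P eps (grad p (x_g P s) - mu_p P *: x_g P s)%R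
         (grad (q_tilde P eps c) (y_g P s)) (cur_x s) (cur_y s))
     + (sel (Mat MulB) + (sel (Mat MulBT) + 0))))%N.
  by rewrite /= calls_bind calls_lift.
have calls_no (V A : Type) (O : matop -> V -> V) (m : prog matop V A) :
    calls (fun=> false) O m = 0%N by elim: m => //= o v k ->.
rewrite !split_calls; split.
  by rewrite (calls_no _ _ _ (solver _ _ _ _ _ _)).
by rewrite (calls_solver P eps) /= -addnA.
Qed.

Lemma calls_algorithm n (P : params R) eps (p : 'cV[R]_n -> R) B c x0 y0 K :
  calls is_grad (oracle p B) (algorithm (@solver R) P eps c x0 y0 K) = K /\
  calls is_mat (oracle p B) (algorithm (@solver R) P eps c x0 y0 K) =
    (K * (2 * inner_steps P eps + 4))%N.
Proof.
elim: K => [//|K [IH1 IH2]].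
rewrite [algorithm _ _ _ _ _ _ _]/= !calls_bind IH1 IH2.
have [-> ->] := calls_iteration P eps p B c
  (run (oracle p B) (algorithm (@solver R) P eps c x0 y0 K)).
by rewrite addn1 mulSn addnC.
Qed.

Definition bias_ratio P : R := L_p P ^+ 2 * D_y P / (mu_p P * lam_min P).
(** Normalized so that the bound of [regularization_error] equals eps / 4 times eps * bias_factor;
    likewise coef_x coef_y = eps * schur_factor * lam_max. [max_eps] keeps both products at most
    1. *)
Definition bias_factor P : R :=
  (bias_ratio P ^+ 2 + D_y P * bias_ratio P / mu_p P) / (16 * D_y P ^+ 4).
Definition schur_factor P : R :=
  coef_x P ^+ 2 / (8 * D_y P ^+ 2 * mu_p P * lam_max P).
Definition max_eps P : R := (1 + `|bias_factor P| + `|schur_factor P|)^-1.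

Definition weight P : R := (8 * D_y P ^+ 2 * mu_p P)^-1.
(** [2 * r + 1] bounds the squared distance of the start to the regularized solution, the middle
    factor turns it into energy, and 4 (1 + 1 / weight) turns the final energy into eps times the
    squared distance, with target eps / 4. *)
Definition outer_factor P (r : R) : R :=
  4 * (1 + (weight P)^-1) * (1 + weight P + eta_x P * L_p P / alpha P) * (2 * r + 1).
Definition log_constant P (r : R) : R := inner_M P + `|outer_factor P r|.

Lemma max_eps_gt0 P : 0 < max_eps P.
Proof. by rewrite invr_gt0 -addrA ltr_pwDl // addr_ge0. Qed.

Lemma max_epsP P eps : 0 < eps -> eps <= max_eps P ->
  [/\ eps <= 1, eps * bias_factor P <= 1 & eps * schur_factor P <= 1].
Proof.
move=> e0; rewrite -[max_eps P]mul1r ler_pdivlMr -?addrA ?ltr_pwDl ?addr_ge0 //.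
move=> h; have n1 := mulr_ge0 (ltW e0) (normr_ge0 (bias_factor P)).
have n2 := mulr_ge0 (ltW e0) (normr_ge0 (schur_factor P)).
have n3 := ler_wpM2l (ltW e0) (ler_norm (bias_factor P)).
have n4 := ler_wpM2l (ltW e0) (ler_norm (schur_factor P)).
split; lra.
Qed.

Lemma inner_M_gt0 P : 0 < inner_M P.
Proof. by rewrite ltr_pwDl // expR_gt0. Qed.

(** A logarithm of at least 1 absorbs the additive constants of the call counts, and one logarithm
    serves both loops. *)
Lemma ln_log_constant_ge P r eps : 0 < eps -> eps <= 1 ->
  1 <= ln (log_constant P r / eps) /\
  ln (inner_M P / eps) <= ln (log_constant P r / eps).
Proof.
move=> e0 e1; have M0 := inner_M_gt0 P.
have ML : inner_M P <= log_constant P r by rewrite lerDl.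
have L0 := lt_le_trans M0 ML.
split; last by rewrite ler_ln ?posrE ?divr_gt0 // ler_pM2r // invr_gt0.
rewrite -[leLHS](@expRK R) ler_ln ?posrE ?expR_gt0 ?divr_gt0 // ler_pdivlMr //.
have : expR 1 <= inner_M P by rewrite lerDl.
have := ler_wpM2l (expR_ge0 1) e1; lra.
Qed.

Lemma sqrt2_le : Num.sqrt 2 <= 3 / 2 :> R.
Proof.
have h : (0 : R) <= 3 / 2 by [].
rewrite -(ger0_norm h) -sqrtr_sqr ler_sqrt ?sqr_ge0 //; lra.
Qed.

Lemma sqrt_ge1 (x : R) : 1 <= x -> 1 <= Num.sqrt x.
Proof. by move=> x1; rewrite -[leLHS]sqrtr1 ler_sqrt // (le_trans ler01). Qed.

Lemma truncn_succ_le (x : R) : 0 <= x -> (Num.truncn x).+1%:R <= x + 1.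
Proof. by move=> x0; rewrite -natr1 lerD2r; have /andP[] := truncn_itv x0. Qed.

Section Rates.
Variable P : params R.
Hypotheses (mu0 : 0 < mu_p P) (muL : mu_p P <= L_p P).

Lemma invf_alpha : (alpha P)^-1 = Num.sqrt (L_p P / mu_p P).
Proof. by rewrite alphaE // -sqrtrV ?divr_ge0 ?ltW ?(lt_le_trans mu0) // invf_div. Qed.

Lemma sqrt_ratio_ge1 : 1 <= Num.sqrt (L_p P / mu_p P).
Proof.
by apply: sqrt_ge1; rewrite ler_pdivlMr // mul1r.
Qed.
End Rates.

Lemma outer_steps_bound P (T : R) : 0 < mu_p P -> mu_p P <= L_p P -> 1 <= T ->
  (Num.truncn (4 / alpha P * (2 * T))).+1%:R <= 9 * Num.sqrt (L_p P / mu_p P) * T.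
Proof.
move=> mu0 muL T1; have A1 := sqrt_ratio_ge1 mu0 muL; rewrite invf_alpha //.
have T0 : 0 <= T by apply: le_trans T1.
have A0 : 0 <= Num.sqrt (L_p P / mu_p P) by exact: sqrtr_ge0.
apply: le_trans (truncn_succ_le _) _; first by rewrite !mulr_ge0.
have := ler_pM ler01 ler01 A1 T1; lra.
Qed.

Lemma inner_steps_bound P eps (T : R) : 0 < lam_min P -> lam_min P <= lam_max P ->
  1 <= T -> ln (inner_M P / eps) <= T ->
  (inner_steps P eps)%:R <= 13 * Num.sqrt (lam_max P / lam_min P) * T.
Proof.
move=> lmin0 lminmax T1 lnT.
have lmax0 := lt_le_trans lmin0 lminmax.
set k := Num.sqrt _.
have k1 : 1 <= k by apply: sqrt_ge1; rewrite ler_pdivlMr // mul1r.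
have T0 : 0 <= T by apply: le_trans T1.
have al : (alpha (inner_params P))^-1 <= 3 / 2 * k.
  rewrite invf_alpha /=; [|exact: lmin0|by rewrite /=; lra].
  rewrite -mulrA sqrtrM // -/k ler_wpM2r ?sqrtr_ge0 //; exact: sqrt2_le.
have al0 : 0 <= (alpha (inner_params P))^-1.
  by rewrite invf_alpha ?sqrtr_ge0 //=; lra.
have kT := ler_pM ler01 ler01 k1 T1.
have hT : 4 / alpha (inner_params P) * (2 * ln (inner_M P / eps)) <= 12 * k * T.
  have h : 8 * (alpha (inner_params P))^-1 * ln (inner_M P / eps) <=
      8 * (alpha (inner_params P))^-1 * T by rewrite ler_wpM2l // mulr_ge0.
  by have := ler_wpM2r T0 al; lra.
rewrite /inner_steps; set x := _ * (2 * _) in hT *.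
have [x0|x0] := leP 0 x; first by have := truncn_succ_le x0; lra.
(* [truncn] is 0 on negative numbers, so a single step is made. *)
have -> : Num.truncn x = 0%N by apply/truncn0Pn; rewrite -ltNge; lra.
lra.
Qed.
End Complexity.

Lemma dot_sub_triangle {R : realType} {n : nat} (x h z : 'cV[R]_n) :
  dot (x - z) (x - z) <= 2 * dot (x - h) (x - h) + 2 * dot (h - z) (h - z).
Proof. by rewrite -[x - z](subrKA h) dotDD. Qed.

Section Convergence.
Context {R : realType} {n : nat}.
Variables (P : params R) (eps : R) (p : 'cV[R]_n -> R) (B : 'M[R]_n)
  (c xs ys xr yr : 'cV[R]_n).
Hypotheses (mu0 : 0 < mu_p P) (muL : mu_p P <= L_p P) (D0 : 0 < D_y P).
Hypotheses (sp : smooth (L_p P) p) (cp : strongly_convex (mu_p P) p).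
Hypotheses (lmin0 : 0 < lam_min P) (lminmax : lam_min P <= lam_max P).
Hypotheses (lminB : forall v, lam_min P * dot v v <= dot v (B *m B^T *m v)).
Hypotheses (lmaxB : forall v, dot v (B *m B^T *m v) <= lam_max P * dot v v).
Hypotheses (eps0 : 0 < eps) (eps1 : eps <= 1).
Hypotheses (coef_le : coef_x P * coef_y P eps <= lam_max P).
Hypotheses (gr : grad p xr + B *m yr = 0) (cr : B^T *m xr - c = mu_q P eps *: yr).
Hypothesis bias : dot (xr - xs) (xr - xs) + dot (yr - ys) (yr - ys) <= eps / 4.

Let weight0 : 0 < weight P.
Proof. by rewrite invr_gt0 !mulr_gt0 // exprn_gt0. Qed.

Let mu_q_weight : mu_q P eps / mu_p P = eps * weight P.
Proof. by rewrite /mu_q /weight; field; rewrite !gt_eqF. Qed.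

Lemma initial_energy (x0 y0 : 'cV[R]_n) :
  energy P eps p xr yr (State x0 y0 x0 y0 x0 y0) <=
  (1 + weight P + eta_x P * L_p P / alpha P) *
  (2 * (dot (x0 - xs) (x0 - xs) + dot (y0 - ys) (y0 - ys)) + 1).
Proof.
have al0 : 0 < alpha P by have /andP[] := alpha_bound mu0 muL.
have e0 := eta_x_gt0 mu0 muL.
rewrite /energy /= mu_q_weight.
have := bregman_smooth xr mu0 sp xr x0.
rewrite bregman_center /bregman_grad !subrr scaler0 subrr dot0l !add0r => br.
have ea0 : 0 <= 2 * eta_x P / alpha P by rewrite divr_ge0 ?mulr_ge0 // ltW.
have := ler_wpM2l ea0 br.
have -> : 2 * eta_x P / alpha P * (L_p P / 2 * dot (x0 - xr) (x0 - xr)) =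
    eta_x P * L_p P / alpha P * dot (x0 - xr) (x0 - xr) by field; rewrite gt_eqF.
have k0 : 0 <= eta_x P * L_p P / alpha P.
  by rewrite divr_ge0 ?mulr_ge0 ?(ltW e0) ?(ltW al0) // (le_trans (ltW mu0)).
have X0 := dot_ge0 (x0 - xr); have Y0 := dot_ge0 (y0 - yr).
have tx := dot_sub_triangle x0 xs xr; have ty := dot_sub_triangle y0 ys yr.
have sx : dot (xs - xr) (xs - xr) = dot (xr - xs) (xr - xs).
  by rewrite -(opprB xr xs) dotNl dotNr opprK.
have sy : dot (ys - yr) (ys - yr) = dot (yr - ys) (yr - ys).
  by rewrite -(opprB yr ys) dotNl dotNr opprK.
have r1 : dot (x0 - xr) (x0 - xr) + dot (y0 - yr) (y0 - yr) <=
    2 * (dot (x0 - xs) (x0 - xs) + dot (y0 - ys) (y0 - ys)) + 1.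
  by have := bias; have := eps1; lra.
have f0 : 0 <= 1 + weight P + eta_x P * L_p P / alpha P by have := ltW weight0; lra.
move=> h; apply: le_trans (ler_wpM2l f0 r1).
have := ler_wpM2r (mulr_ge0 (ltW weight0) Y0) eps1.
have := mulr_ge0 (ltW weight0) X0; have := mulr_ge0 k0 Y0.
lra.
Qed.

(** The energy controls y only with weight eps * weight, hence eps (X + Y) is what it bounds, and it
    must shrink to order eps^2: this is the factor 2 before [T]. Then X + Y and the bias are at most
    eps / 4 each, and the triangle inequality doubles both. *)
Lemma final_accuracy (x0 y0 : 'cV[R]_n) (r T : R) :
  r = dot (x0 - xs) (x0 - xs) + dot (y0 - ys) (y0 - ys) ->
  T = ln (log_constant P r / eps) ->
  let st := run (oracle p B) (algorithm (@solver R) P eps c x0 y0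
    (Num.truncn (4 / alpha P * (2 * T))).+1) in
  eps_solution eps xs ys (cur_x st) (cur_y st).
Proof.
move=> Er ET; move EK: (Num.truncn _).+1 => K st.
have al01 := alpha_bound mu0 muL; have /andP[al0 al1] := al01.
have e0 := eta_x_gt0 mu0 muL.
have M0 : 0 < log_constant P r by rewrite ltr_pwDl // inner_M_gt0.
have M1 : 1 <= log_constant P r.
  rewrite /log_constant /inner_M -addrA; apply: ler_wpDr; first by rewrite addr_ge0.
  by rewrite -[leLHS]expR0 ler_expR.
have MF : outer_factor P r <= log_constant P r ^+ 2.
  apply: (@le_trans _ _ (log_constant P r)).
    by apply: le_trans (ler_norm _) _; rewrite lerDr ltW // inner_M_gt0.
  by rewrite expr2 ler_peMl // ltW.
have decay : (1 - alpha P / 4) ^+ K * log_constant P r ^+ 2 <= eps ^+ 2.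
  have : (1 - alpha P / 4) ^+ K * (log_constant P r / eps) ^+ 2 <= 1.
    apply: geometric_decay; rewrite ?exprn_gt0 ?divr_gt0 //.
    rewrite lnXn ?divr_gt0 // -[ln _ *+ 2]mulr_natl -ET -EK; exact/ltW/truncnS_gt.
  by rewrite expr_div_n mulrA ler_pdivrMr ?exprn_gt0 // mul1r.
have Eend := run_algorithm mu0 muL D0 sp cp lmin0 lminmax lminB lmaxB eps0 eps1 coef_le
  gr cr x0 y0 K.
rewrite -/st in Eend.
have q0 : 0 <= (1 - alpha P / 4) ^+ K by rewrite exprn_ge0 //; lra.
have := le_trans Eend (ler_wpM2l q0 (initial_energy x0 y0)); rewrite -Er.
set G := (1 + weight P + _) * _ => E1.
have EF : outer_factor P r = 4 * (1 + (weight P)^-1) * G by rewrite /G mulrA.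
have w1 : 0 <= 1 + (weight P)^-1 by rewrite addr_ge0 // invr_ge0 ltW.
have tx := dot_sub_triangle (cur_x st) xr xs; have ty := dot_sub_triangle (cur_y st) yr ys.
rewrite /eps_solution !enorm_sqr.
have X0 := dot_ge0 (cur_x st - xr); have Y0 := dot_ge0 (cur_y st - yr).
move: E1; rewrite /energy mu_q_weight.
have b0 : 0 <= 2 * eta_x P / alpha P * bregman P p xr (cur_xf st).
  by rewrite mulr_ge0 ?bregman_ge0 // divr_ge0 ?mulr_ge0 // ltW.
move: X0 Y0 tx ty; set X := dot (_ - xr) _; set Y := dot (_ - yr) _ => X0 Y0 tx ty E1.
have E2 : X + eps * weight P * Y <= (1 - alpha P / 4) ^+ K * G by lra.
have E3 : eps * (X + Y) <= (1 + (weight P)^-1) * (X + eps * weight P * Y).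
  have -> : (1 + (weight P)^-1) * (X + eps * weight P * Y) =
      X + eps * Y + ((weight P)^-1 * X + eps * weight P * Y).
    by field; rewrite gt_eqF.
  have h1 := ler_wpM2r X0 eps1.
  have h2 : 0 <= (weight P)^-1 * X by rewrite mulr_ge0 // invr_ge0 ltW.
  have h3 : 0 <= eps * weight P * Y by rewrite !mulr_ge0 // ltW.
  lra.
have E4 : eps * (X + Y) <= eps * (eps / 4).
  apply: le_trans E3 _; apply: le_trans (ler_wpM2l w1 E2) _.
  have := le_trans (ler_wpM2l q0 MF) decay; rewrite EF; lra.
have : X + Y <= eps / 4 by rewrite -(ler_pM2l eps0).
have := bias; lra.
Qed.
End Convergence.

Theorem corollary1 (R : realType) :
  exists (C : R) (solve : inner_method R)
         (eps0 : params R -> R) (M : params R -> R -> R),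
  0 < C /\ (forall P, 0 < eps0 P) /\ (forall P r, 0 < M P r) /\
  forall (n : nat) (P : params R)
         (p : 'cV[R]_n -> R) (B : 'M[R]_n) (c xs ys : 'cV[R]_n),
    0 < mu_p P ->
    smooth (L_p P) p ->
    strongly_convex (mu_p P) p ->
    posdef B ->
    (exists u : 'cV[R]_n, c = B *m u) ->
    largest_eigenvalue (B *m B^T) (lam_max P) ->
    smallest_eigenvalue (B *m B^T) (lam_min P) ->
    saddle_point (saddle_obj p B c) xs ys ->
    0 < D_y P ->
    enorm ys <= D_y P ->
    forall (x0 y0 : 'cV[R]_n) (eps : R),
      0 < eps -> eps <= eps0 P ->
      let alg := algorithm solve P eps c x0 y0 in
      let st := fun k : nat => run (oracle p B) (alg k) in
      let log_term :=
        ln (M P (enorm (x0 - xs) ^+ 2 + enorm (y0 - ys) ^+ 2) / eps) in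
      exists K : nat,
        (forall k : nat, (k < K)%N ->
           accurate P eps p B c (x_g P (st k)) (y_g P (st k))
             (cur_x (st k)) (cur_y (st k))
             (cur_xh (st k.+1)) (cur_yh (st k.+1))) /\
        eps_solution eps xs ys (cur_x (st K)) (cur_y (st K)) /\
        (calls is_grad (oracle p B) (alg K))%:R
          <= C * Num.max 1 (Num.sqrt (L_p P / mu_p P)) * log_term /\
        (calls is_mat (oracle p B) (alg K))%:R
          <= C * Num.sqrt (L_p P * lam_max P / (mu_p P * lam_min P))
             * log_term ^+ 2.
Proof.
(* 270 = 9 * 30: at most 9 sqrt (L_p / mu_p) T outer iterations, each with 2 * 13 + 4 = 30 times
   sqrt (lam_max / lam_min) T products. *)
exists 270, (@solver R), (@max_eps R), (@log_constant R).
split; first by [].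
split; first exact: max_eps_gt0.
split=> [P r|]; first by rewrite ltr_pwDl // inner_M_gt0.
move=> n P p B c xs ys mu0 sp cp pB _ [emax lmaxP] [emin lminP] sd D0 ysD x0 y0 eps
  eps0 eps_small alg st T.
have [v v0 lmin0] := eigenvalue_gram_gt0 pB emin.
have muL := strongly_convex_le_smooth sp cp v0.
have L0 := lt_le_trans mu0 muL.
have lminmax := lminP _ emax; have lmax0 := lt_le_trans lmin0 lminmax.
have symA : (B *m B^T)^T = B *m B^T by rewrite trmx_mul trmxK.
have lminB := rayleigh_min symA lminP; have lmaxB := rayleigh_max symA lmaxP.
have [eps1 eps_bias eps_schur] := max_epsP eps0 eps_small.
have coef_le : coef_x P * coef_y P eps <= lam_max P.
  rewrite coef_yE //; have := ler_wpM2r (ltW lmax0) eps_schur; rewrite mul1r.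
  apply: le_trans; rewrite le_eqVlt; apply/orP; left; apply/eqP.
  by rewrite /schur_factor; field; rewrite !gt_eqF.
have nu0 : 0 < mu_q P eps by rewrite divr_gt0 // mulr_gt0 // exprn_gt0.
have psd u : 0 <= dot u (B *m B^T *m u) by rewrite -mulmxA dot_mulmx dot_ge0.
have [gs cs] := saddle_point_stationary sp L0 sd.
have [xr [yr [gr cr]]] := exists_regularized_solution c mu0 sp cp L0 nu0 lmax0 psd lmaxB.
have bias : dot (xr - xs) (xr - xs) + dot (yr - ys) (yr - ys) <= eps / 4.
  have lB := mulmx_lower_bound (posdef_unitmx pB) lmin0 lminB.
  apply: le_trans (regularization_error mu0 sp cp (erefl (bias_ratio P))
    L0 nu0 lmin0 D0 lB ysD gs cs gr cr) _.
  have -> : mu_q P eps ^+ 2 * (bias_ratio P ^+ 2 + D_y P * bias_ratio P / mu_p P) =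
      eps / 4 * (eps * bias_factor P).
    rewrite /bias_factor /mu_q; move: (bias_ratio P) => q.
    by field; rewrite !gt_eqF.
  by rewrite -[leRHS]mulr1 ler_wpM2l // ltW // divr_gt0.
have [T1 innerT] := ln_log_constant_ge P
  (enorm (x0 - xs) ^+ 2 + enorm (y0 - ys) ^+ 2) eps0 eps1.
rewrite -/T in T1 innerT.
have [Kgrad Kmat] := calls_algorithm P eps p B c x0 y0
  (Num.truncn (4 / alpha P * (2 * T))).+1.
exists (Num.truncn (4 / alpha P * (2 * T))).+1; split; [|split].
- move=> k _; rewrite /st /alg [algorithm _ _ _ _ _ _ k.+1]/= run_bind.
  exact: (run_iteration mu0 muL D0 sp cp lmin0 lminmax lminB lmaxB eps0 eps1
    coef_le gr cr _).1.
- apply: (final_accuracy mu0 muL D0 sp cp lmin0 lminmax lminB lmaxB eps0 eps1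
    coef_le gr cr bias (erefl _)).
  by rewrite -!enorm_sqr.
have A1 := sqrt_ratio_ge1 mu0 muL.
have KT := outer_steps_bound mu0 muL T1.
have T0 : 0 <= T := le_trans ler01 T1.
have A0 : 0 <= Num.sqrt (L_p P / mu_p P) := sqrtr_ge0 _.
split; rewrite /alg ?Kgrad ?Kmat.
  apply: le_trans KT _; rewrite max_r //.
  by have := mulr_ge0 A0 T0; lra.
have -> : L_p P * lam_max P / (mu_p P * lam_min P) =
    L_p P / mu_p P * (lam_max P / lam_min P) by field; rewrite !gt_eqF.
rewrite sqrtrM ?divr_ge0 ?(ltW L0) ?(ltW mu0) //.
have NT := inner_steps_bound lmin0 lminmax T1 innerT.
have k1 : 1 <= Num.sqrt (lam_max P / lam_min P).
  by apply: sqrt_ge1; rewrite ler_pdivlMr // mul1r.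
have kT := ler_pM ler01 ler01 k1 T1.
rewrite natrM natrD natrM.
have N4 : 2%:R * (inner_steps P eps)%:R + 4%:R <= 30 * Num.sqrt (lam_max P / lam_min P) * T.
  lra.
have N0 : 0 <= 2%:R * (inner_steps P eps)%:R + 4%:R :> R by rewrite addr_ge0 ?mulr_ge0.
apply: le_trans (ler_pM (ler0n _ _) N0 KT N4) _.
by rewrite le_eqVlt; apply/orP; left; apply/eqP; ring.
Qed.
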